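(* Let $n>2$, and let $X_1=\frac{\partial}{\partial x_1}$ and $X_j=x_1^{k_{j,1}}x_2^{k_{j,2}}\cdots x_{j-1}^{k_{j,j-1}}\frac{\partial}{\partial x_j}$ for $2\le j\le n$ on $\mathbb{R}^n$, where the $k_{j,l}$ ($1\le l<j\le n$) are non-negative integers, and $X=(X_1,\dots,X_n)$. For $2\le j\le n$ and $1\le i\le j-1$ let $$R_{j,i}=\sum_{l_1=i}^{j-1}\ \sum_{l_2=i-1}^{l_1-1}\ \sum_{l_3=i-2}^{l_2-1}\cdots\sum_{l_i=1}^{l_{i-1}-1}k_{j,l_1}k_{l_1,l_2}k_{l_2,l_3}\cdots k_{l_{i-1},l_i}$$ (so $R_{j,1}=\sum_{l_1=1}^{j-1}k_{j,l_1}$). Let $$1<p<\frac{n+\sum_{j=2}^n\sum_{i=1}^{j-1}R_{j,i}}{n-2+\sum_{j=2}^n\sum_{i=1}^{j-1}R_{j,i}}.$$ Let $u_0\in L^1_{\mathrm{loc}}(\mathbb{R}^n)$. If $f\in L^1_{\mathrm{loc}}(\mathbb{R}^n)$ with $\int_{\mathbb{R}^n}f(x)\,dx>0$, then the problem $u_t-\Delta_X u=|u|^p+f(x)$ in $(0,\infty)\times\mathbb{R}^n$, $u(0,x)=u_0(x)$, does not admit a global in time weak solution.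
   Context: For a system $X=(X_1,\dots,X_m)$ of real $C^\infty$ vector fields, $\Delta_X=-\sum_{k=1}^m X_k^\ast X_k$ with $X_k^\ast=-X_k-\operatorname{div}X_k$; here the vector fields are divergence free, so $\Delta_X=\sum_{j=1}^n X_j^2$. Weak solution: for $f,u_0\in L^1_{\mathrm{loc}}(\mathbb{R}^n)$, a function $u\in L^p_{\mathrm{loc}}((0,T),L^p_{\mathrm{loc}}(\mathbb{R}^n))$ is a local in time weak solution (on $[0,T)$) of $u_t-\Delta_X u=|u|^p+f(x)$, $u(0,x)=u_0(x)$, if for every non-negative test function $\psi\in C^1_c([0,T);C^2_c(\mathbb{R}^n))$ one has $\int_0^T\!\int_{\mathbb{R}^n}|u|^p\psi+\int_{\mathbb{R}^n}u_0\psi(0,x)+\int_0^T\!\int_{\mathbb{R}^n}f\psi+\int_0^T\!\int_{\mathbb{R}^n}u\psi_t+\int_0^T\!\int_{\mathbb{R}^n}u\,\Delta_X\psi=0$. When $T=\infty$, such $u$ is called a global in time weak solution. *)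

(* Defs.v *)
From HB Require Import structures.
From mathcomp Require Import all_boot all_order all_algebra.
From mathcomp Require Import all_classical all_reals all_analysis.

Set Implicit Arguments.
Unset Strict Implicit.
Unset Printing Implicit Defensive.

Import Order.TTheory GRing.Theory Num.Theory.
Import numFieldNormedType.Exports.

Local Open Scope classical_set_scope.
Local Open Scope ring_scope.

(** R^n is ['rV[R]_n], with the library's topology and norm.  Its sigma-algebra
    is the one generated by the coordinates (the Borel sets when [T] is the
    real line), as the library does for tuples. *)

Definition measure_row_display : measure_display -> measure_display.
Proof. exact. Qed.

Section measurable_row.
Context {d} {T : measurableType d}.
Variable n : nat.

Let coords : 'I_n -> 'rV[T]_n -> T := fun i x => x 0 i.

Let row_set0 : g_sigma_preimage coords set0.
Proof. exact: sigma_algebra0. Qed.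

Let row_setC A : g_sigma_preimage coords A -> g_sigma_preimage coords (~` A).
Proof. exact: sigma_algebraC. Qed.

Let row_bigcup (F : _^nat) : (forall i, g_sigma_preimage coords (F i)) ->
  g_sigma_preimage coords (\bigcup_i (F i)).
Proof. exact: sigma_algebra_bigcup. Qed.

HB.instance Definition _ := @isMeasurable.Build (measure_row_display d)
  'rV[T]_n (g_sigma_preimage coords) row_set0 row_setC row_bigcup.

End measurable_row.

Lemma measurable_coord d (T : measurableType d) n (i : 'I_n) :
  measurable_fun [set: 'rV[T]_n] (fun x => x 0 i).
Proof.
move=> _ Y mY; rewrite setTI; apply: sub_sigma_algebra => /=.
rewrite -bigcup_seq/=; exists i => /=; first by rewrite mem_index_enum.
by exists Y => //; rewrite setTI.
Qed.

Lemma measurable_fun_coordP d1 d2 (T1 : measurableType d1)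
    (T2 : measurableType d2) n (f : T1 -> 'rV[T2]_n) :
  measurable_fun [set: T1] f <->
  forall i, measurable_fun [set: T1] (fun x => f x 0 i).
Proof.
split=> [mf i|mf].
  by apply: (measurableT_comp (measurable_coord i)).
move=> _ A mA; rewrite setTI.
have : preimage_set_system setT f (@measurable _ 'rV[T2]_n) (f @^-1` A).
  by exists A => //; rewrite setTI.
have -> : @measurable _ 'rV[T2]_n =
  g_sigma_preimage (fun (i : 'I_n) (x : 'rV[T2]_n) => x 0 i) by [].
rewrite -g_sigma_preimage_comp; apply: smallest_sub.
  exact: sigma_algebra_measurable.
move=> B; rewrite -bigcup_seq => -[i _] /= [C mC <-].
exact: mf.
Qed.

Lemma product_sigma_finite d1 d2 (T1 : measurableType d1)
    (T2 : measurableType d2) (R : realType)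
    (m1 : {sigma_finite_measure set T1 -> \bar R})
    (m2 : {sigma_finite_measure set T2 -> \bar R}) :
  sigma_finite setT (m1 \x m2)%E.
Proof.
have /sigma_finiteP[F [TF ndF Foo]] := sigma_finiteT m1.
have /sigma_finiteP[G [TG ndG Goo]] := sigma_finiteT m2.
exists (fun n => F n `*` G n).
  rewrite -setXTT TF TG predeqE => -[x y]; split.
    move=> [/= [n _ Fnx] [k _ Gky]]; exists (maxn n k) => //; split.
    - by move: x Fnx; exact/subsetPset/ndF/leq_maxl.
    - by move: y Gky; exact/subsetPset/ndG/leq_maxr.
  by move=> [n _ []/= ? ?]; split; exists n.
move=> k; have [? ?] := Foo k; have [? ?] := Goo k.
split; first exact: measurableX.
by rewrite product_measure1E// lte_mul_pinfty// ge0_fin_numE.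
Qed.

Section lebesgue_row.
Variable R : realType.

Definition row_cons n (z : measurableTypeR R * 'rV[R]_n) : 'rV[R]_n.+1 :=
  row_mx (const_mx z.1 : 'rV_1) z.2.

Definition row_uncons n (x : 'rV[R]_n.+1) : measurableTypeR R * 'rV[R]_n :=
  (x 0 ord0, \row_i x 0 (lift ord0 i)).

Lemma row_cons0 n (z : measurableTypeR R * 'rV[R]_n) :
  row_cons z 0 ord0 = z.1.
Proof.
rewrite (_ : ord0 = lshift n (ord0 : 'I_1)); last exact/val_inj.
by rewrite [LHS]row_mxEl mxE.
Qed.

Lemma row_consS n (z : measurableTypeR R * 'rV[R]_n) i :
  row_cons z 0 (lift ord0 i) = z.2 0 i.
Proof.
rewrite (_ : lift ord0 i = rshift 1 i); last exact/val_inj.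
by rewrite [LHS]row_mxEr.
Qed.

Lemma row_consK n : cancel (@row_cons n) (@row_uncons n).
Proof.
move=> [a x]; congr (_, _) => /=; first exact: row_cons0.
by apply/rowP => i; rewrite mxE row_consS.
Qed.

Lemma measurable_row_cons n : measurable_fun setT (@row_cons n).
Proof.
apply/measurable_fun_coordP => i; case: (unliftP ord0 i) => [j|] ->.
  under eq_fun do rewrite row_consS.
  by apply: (measurableT_comp (measurable_coord j)).
under eq_fun do rewrite row_cons0.
exact: measurable_fst.
Qed.

Lemma measurable_row_uncons n : measurable_fun setT (@row_uncons n).
Proof.
apply/measurable_fun_pairP; split; first exact: measurable_coord.
apply/measurable_fun_coordP => i; rewrite /=.
under eq_fun do rewrite mxE.
exact: measurable_coord.
Qed.

Section step.
Variables (n : nat) (m : {sigma_finite_measure set 'rV[R]_n -> \bar R}).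

Definition lebesgue_row_step : set 'rV[R]_n.+1 -> \bar R :=
  pushforward (@lebesgue_measure R \x m)%E (@row_cons n).

HB.instance Definition _ := Measure.copy lebesgue_row_step
  (measure_function_pushforward__canonical__measure_function_Measure
    (lebesgue_measure \x m)%E (@measurable_row_cons n)).

Let lebesgue_row_step_sigma_finite : sigma_finite setT lebesgue_row_step.
Proof.
have [F TF Foo] := product_sigma_finite (@lebesgue_measure R) m.
exists (fun i => @row_uncons n @^-1` F i).
  by rewrite -preimage_bigcup -TF preimage_setT.
move=> i; have [mF Fi] := Foo i; split.
  by rewrite -[X in measurable X]setTI; exact: measurable_row_uncons.
rewrite /lebesgue_row_step /pushforward -comp_preimage.
rewrite (_ : _ \o _ = id)//.
by apply/funext => z; exact: row_consK.
Qed.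

HB.instance Definition _ := Measure_isSigmaFinite.Build _ _ _
  lebesgue_row_step lebesgue_row_step_sigma_finite.

End step.

(** Lebesgue measure on R^n is the n-fold product of the one-dimensional
    Lebesgue measure, transported along (t, x) |-> (t, x_1, .., x_n); R^0 is a
    point of mass 1. *)
Fixpoint lebesgue_row n : {sigma_finite_measure set 'rV[R]_n -> \bar R} :=
  match n with
  | 0 => dirac (0 : 'rV[R]_0)
  | n'.+1 => lebesgue_row_step (lebesgue_row n')
  end.

End lebesgue_row.

Lemma lebesgue_row_box (R : realType) n (A : 'I_n -> set R) :
  (forall i, measurable (A i)) ->
  lebesgue_row R n [set x | forall i, A i (x 0 i)] =
  (\prod_(i < n) @lebesgue_measure R (A i))%E.
Proof.
elim: n A => [|n IH] A mA.
  by rewrite big_ord0 /= diracE mem_set//; case.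
rewrite big_ord_recl -(IH (fun i => A (lift ord0 i)))//.
have mB : measurable [set x : 'rV[R]_n | forall i, A (lift ord0 i) (x 0 i)].
  rewrite (_ : mkset _ = \bigcap_(i in [set: 'I_n])
      ((fun x : 'rV[R]_n => x 0 i) @^-1` A (lift ord0 i))).
    apply: fin_bigcap_measurable => // i _.
    by rewrite -[X in measurable X]setTI; exact: measurable_coord.
  by apply/seteqP; split=> x /= Ax i; [move=> _|]; exact: Ax.
rewrite -(product_measure1E (@lebesgue_measure R) (lebesgue_row R n)
  (mA ord0) mB).
rewrite /= /lebesgue_row_step /pushforward; congr ((_ \x _)%E _).
apply/seteqP; split=> z /=.
  by move=> Az; split=> [|i]; [rewrite -(row_cons0 z)|rewrite -row_consS].
by move=> [Az0 Az] i; case: (unliftP ord0 i) => [j|] ->;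
  rewrite ?row_consS ?row_cons0.
Qed.

Section vector_fields.
Variables (R : realType) (n : nat).
Local Notation Rn := 'rV[R]_n.
Implicit Types (X : Rn -> Rn) (phi : Rn -> R) (i : 'I_n).

Definition pderiv i phi : Rn -> R := fun x => 'D_(delta_mx 0 i) phi x.

Definition vf_apply X phi : Rn -> R := fun x => 'D_(X x) phi x.

Definition vf_div X : Rn -> R :=
  fun x => \sum_(i < n) pderiv i (fun y => X y 0 i) x.

Definition vf_adjoint X phi : Rn -> R :=
  fun x => - vf_apply X phi x - vf_div X x * phi x.

Definition vf_laplacian m (X : 'I_m -> Rn -> Rn) phi : Rn -> R :=
  fun x => - \sum_(k < m) vf_adjoint (X k) (vf_apply (X k) phi) x.

(** The exponents [k j l] are numbered from 1, ordinals from 0: the index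
    [j : 'I_n] stands for the [j.+1]-th coordinate. *)
Definition monomial_vf (k : nat -> nat -> nat) (j : 'I_n) : Rn -> Rn :=
  fun x => (\prod_(l < n | (l < j)%N) x 0 l ^+ k j.+1 l.+1) *: delta_mx 0 j.

End vector_fields.

(** R_{j,i}, by recursion on the number [i] of nested sums: the outermost index
    l_1 ranges over i, .., j-1, and what remains is R_{l_1,i-1}, with the
    convention R_{j,0} = 1. *)
Fixpoint nested_sum (k : nat -> nat -> nat) (j i : nat) : nat :=
  match i with
  | 0 => 1%N
  | i'.+1 => (\sum_(i'.+1 <= l < j) k j l * nested_sum k l i')%N
  end.

Definition total_nested_sum (k : nat -> nat -> nat) (n : nat) : nat :=
  (\sum_(2 <= j < n.+1) \sum_(1 <= i < j) nested_sum k j i)%N.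

Section weak_solutions.
Variables (R : realType) (n : nat).
Local Notation Rn := 'rV[R]_n.
Local Notation leb1 := (@lebesgue_measure R).
Local Notation lebn := (lebesgue_row R n).

(** [pderivs [:: i_1; ..; i_r] phi] is d_{i_1} .. d_{i_r} phi. *)
Definition pderivs (s : seq 'I_n) (phi : Rn -> R) : Rn -> R :=
  foldr (@pderiv R n) phi s.

Definition is_Ck (r : nat) (phi : Rn -> R) : Prop :=
  (forall s i x, (size s < r)%N ->
     derivable (pderivs s phi) x (delta_mx 0 i)) /\
  (forall s, (size s <= r)%N -> continuous (pderivs s phi)).

(** Convergence in the C^2 norm: uniform convergence on R^n of all partial
    derivatives of order at most 2. *)
Definition C2_cvg (F : set_system R) (g : R -> Rn -> R) (phi : Rn -> R) : Prop :=
  forall s, (size s <= 2)%N -> forall e : R, 0 < e ->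
    \forall t \near F, forall x, `|pderivs s (g t) x - pderivs s phi x| <= e.

(** The space C^1_c([0,T); C^2_c(R^n)): functions on [0,T) with compact support
    that are C^1 (one-sidedly at 0) as maps into the space C^2_K of C^2 functions
    supported in some compact K, normed by the C^2 norm.  As a compact subset of
    the inductive limit C^2_c lies in one C^2_K, K does not depend on the time.
    Values at times outside [0,T) are irrelevant. *)
Definition test_function (T : \bar R) (psi : R -> Rn -> R) : Prop :=
  let J := [set t : R | 0 <= t /\ (t%:E < T)%E] in
  (exists2 T' : R, (T'%:E < T)%E &
     forall t, J t -> T' < t -> forall x, psi t x = 0) /\
  (exists2 K : set Rn, compact K &
     forall t, J t -> forall x, ~ K x -> psi t x = 0) /\
  (forall t, J t -> is_Ck 2 (psi t)) /\
  exists dpsi : R -> Rn -> R,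
    forall t, J t ->
      [/\ is_Ck 2 (dpsi t),
          C2_cvg (within J t^')
            (fun r x => (r - t)^-1 * (psi r x - psi t x)) (dpsi t) &
          C2_cvg (within J (nbhs t)) dpsi (dpsi t)].

Definition L1loc (f : Rn -> R) : Prop :=
  measurable_fun setT f /\
  forall K : set Rn, compact K -> (\int[lebn]_(x in K) `|f x|%:E < +oo)%E.

Definition Lploc_Lploc (T : \bar R) (p : R) (u : R -> Rn -> R) : Prop :=
  let I := [set t : R | 0 < t /\ (t%:E < T)%E] in
  measurable_fun (I `*` [set: Rn]) (fun z : R * Rn => u z.1 z.2) /\
  forall (J : set R) (K : set Rn), J `<=` I -> compact J -> compact K ->
    (\int[leb1]_(t in J) \int[lebn]_(x in K) (`|u t x| `^ p)%:E < +oo)%E.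

(** The identity is between extended reals.  As a sum with an infinite term is
    infinite (and +oo - oo = -oo, both for sums and inside integrals), it
    includes the requirement that each of the five terms be finite. *)
Definition weak_solution m (X : 'I_m -> Rn -> Rn) (p : R) (f u0 : Rn -> R)
    (T : \bar R) (u : R -> Rn -> R) : Prop :=
  let I := [set t : R | 0 < t /\ (t%:E < T)%E] in
  Lploc_Lploc T p u /\
  forall psi : R -> Rn -> R, test_function T psi ->
    (forall t x, 0 <= t -> (t%:E < T)%E -> 0 <= psi t x) ->
    (\int[leb1]_(t in I) \int[lebn]_x (`|u t x| `^ p * psi t x)%:E
     + \int[lebn]_x (u0 x * psi 0 x)%:E
     + \int[leb1]_(t in I) \int[lebn]_x (f x * psi t x)%:E
     + \int[leb1]_(t in I) \int[lebn]_x (u t x * 'D_1 (psi ^~ x) t)%:E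
     + \int[leb1]_(t in I) \int[lebn]_x (u t x * vf_laplacian X (psi t) x)%:E
     = 0)%E.

Definition global_weak_solution m (X : 'I_m -> Rn -> Rn) (p : R)
    (f u0 : Rn -> R) (u : R -> Rn -> R) : Prop :=
  weak_solution X p f u0 +oo%E u.

End weak_solutions.

(* Main.v *)
Require Import Defs.
From HB Require Import structures.
From mathcomp Require Import all_boot all_order all_algebra.
From mathcomp Require Import all_classical all_reals all_analysis.
From mathcomp Require Import measurable_realfun.
From mathcomp Require Import ring lra zify.
Set Implicit Arguments.
Unset Strict Implicit.
Unset Printing Implicit Defensive.
Import Order.TTheory GRing.Theory Num.Theory.
Import numFieldNormedType.Exports.
Local Open Scope classical_set_scope.
Local Open Scope ring_scope.

(** The dilations x_j |-> rho^(sigma_j) x_j, with sigma_1 = 1 and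
    sigma_j = 1 + \sum_(l < j) k_{j,l} sigma_l, make every X_j homogeneous of
    degree 1, and Q = \sum_j sigma_j = n + \sum_(j,i) R_{j,i}.  Test the equation
    with psi(t,x) = w(t/T) phi(x), phi(x) = \prod_l w(x_l / rho^(sigma_l)), where
    w(s) = max(0, 1 - s^2)^N with N so large that |w'| and |w''| are bounded by a
    multiple of w^(1/p).  Then |psi_t| <= C T^-1 psi^(1/p) and
    |Delta_X psi| <= C rho^-2 psi^(1/p), so by Young's inequality the terms in u
    are absorbed by \int |u|^p psi, up to T vol(box) (T^-q + rho^(-2q)) with
    1/p + 1/q = 1 and vol(box) = 2^n rho^Q.  Divide by T: as T -> oo for fixed
    rho, the term in u_0 disappears and \int f phi <= C rho^(Q - 2q) remains.
    The condition on p says exactly Q < 2q, so rho -> oo contradicts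
    \int f > 0. *)

(** * The cut-off profile *)

Section profile.
Variable R : realType.
Implicit Types (s y : R) (N a : nat).

(** Away from [0] the function is locally [0] or a monomial. At [0] the difference quotient is
    [h ^+ m * Num.max 0 h], which tends to [0]. *)
Lemma is_derive_max0X m s :
  is_derive s 1 (fun y : R => Num.max 0 y ^+ m.+2)
    (m.+2%:R * Num.max 0 s ^+ m.+1).
Proof.
have [s0|s0|->] := ltgtP s 0.
- apply: (@near_eq_is_derive _ _ _ (cst 0)).
    near=> y; rewrite /cst max_l ?expr0n// ltW//.
    by near: y; exact: lt_nbhsl.
  by rewrite expr0n mulr0; exact: is_derive_cst.
- apply: (@near_eq_is_derive _ _ _ (fun y : R => y ^+ m.+2)).
    near=> y; rewrite max_r// ltW//.
    by near: y; exact: lt_nbhsr.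
  have := @is_deriveX R R id m.+2 s 1 1 (is_derive_id _ _).
  by rewrite exprfctE /GRing.scale /= mulr1.
rewrite expr0n mulr0.
have H : h^-1 *: (((fun y : R => Num.max 0 y ^+ m.+2) \o shift 0) (h *: 1)
    - Num.max 0 0 ^+ m.+2) @[h --> 0^'] --> (0 : R).
  rewrite [X in _ --> X](_ : 0 = (0 : R) ^+ m * Num.max 0 0 :> R); last first.
    by rewrite maxxx mulr0.
  apply: (@cvg_trans _ ((fun h : R => h ^+ m * Num.max 0 h) @ 0^')).
    apply: near_eq_cvg; near=> h.
    have h0 : h != 0 by near: h; exact: nbhs_dnbhs_neq.
    rewrite /= addr0 maxxx expr0n subr0 /GRing.scale /= mulr1.
    case: (leP h 0) => [hle|hge]; first by rewrite mulr0 expr0n mulr0.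
    by rewrite [in RHS]exprS mulKf ?exprSr.
  apply: cvg_within_filter.
  apply: cvgM; first exact: exprn_continuous.
  by apply: (@continuous_max R R (cst 0) id); [exact: cvg_cst|exact: cvg_id].
apply: DeriveDef; first by apply/cvg_ex; exists 0.
by apply: cvg_lim.
Unshelve. all: end_near.
Qed.

Let cap s : R := Num.max 0 (1 - s ^+ 2).

(** [bump N a] is the [a]-th derivative of [max 0 (1 - s^2) ^ (N + 3)], for
    [a <= 2]; the junk value for larger [a] is 0. *)
Definition bump N a s : R :=
  match a with
  | 0 => cap s ^+ N.+3
  | 1 => N.+3%:R * cap s ^+ N.+2 * (- (2 * s))
  | 2 => N.+3%:R * (N.+2%:R * cap s ^+ N.+1) * (2 * s) ^+ 2
         - 2 * N.+3%:R * cap s ^+ N.+2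
  | _ => 0
  end.

Let is_derive_capX m s :
  is_derive s 1 (fun y => cap y ^+ m.+2) (m.+2%:R * cap s ^+ m.+1 * (- (2 * s))).
Proof.
have := @is_derive1_comp R (fun y => Num.max 0 y ^+ m.+2)
  (cst 1 - id ^+ 2) s _ _ (is_derive_max0X m _) _; apply.
by apply: is_derive_eq; rewrite sub0r scaler1 expr1.
Qed.

Lemma is_derive_bump N a s : (a < 2)%N ->
  is_derive s 1 (bump N a) (bump N a.+1 s).
Proof.
case: a => [|[|//]] _ /=; first exact: is_derive_capX.
have -> : bump N 1 = (N.+3%:R *: (fun y => cap y ^+ N.+2)) * (- 2 *: id).
  by apply/funext => y; rewrite /bump -mulNr.
have ? := is_derive_capX N s.
apply: is_derive_eq; rewrite !scalrfctE /GRing.scale/=; ring.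
Qed.

Lemma cap_ge0 s : 0 <= cap s. Proof. by rewrite le_max lexx. Qed.

Lemma cap_le1 s : cap s <= 1.
Proof. by rewrite ge_max ler01 lerBlDr lerDl sqr_ge0. Qed.

Lemma continuous_bump N a : continuous (bump N a).
Proof.
have ccap : continuous cap.
  move=> s; apply: (@continuous_max R R (cst 0) (fun s => 1 - s ^+ 2)).
    exact: cvg_cst.
  by apply: cvgB; [exact: cvg_cst|exact: exprn_continuous].
have ccapX m : continuous (fun s => cap s ^+ m).
  move=> s; apply: (@continuous_comp _ _ _ cap (fun y => y ^+ m)).
    exact: ccap.
  exact: exprn_continuous.
have c2 : continuous (fun s : R => 2 * s) by exact: mulrl_continuous.
move=> s; case: a => [|[|[|a]]] /=.
- exact: ccapX.
- apply: cvgM; last by apply: cvgN; exact: c2.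
  by apply: cvgM; [exact: cvg_cst|exact: ccapX].
- apply: cvgB; apply: cvgM.
  + apply: cvgM; first exact: cvg_cst.
    by apply: cvgM; [exact: cvg_cst|exact: ccapX].
  + apply: (@continuous_comp _ _ _ (fun s : R => 2 * s) (fun y => y ^+ 2)).
      exact: c2.
    exact: exprn_continuous.
  + exact: cvg_cst.
  + exact: ccapX.
- exact: cvg_cst.
Qed.

Lemma bump_out N a s : 1 <= `|s| -> bump N a s = 0.
Proof.
move=> s1; have c0 : cap s = 0.
  by rewrite /cap max_l// subr_le0 -real_normK ?num_real// exprn_ege1.
by case: a => [|[|[|a]]] //=; rewrite c0 !expr0n/= ?mulr0 ?mul0r ?subr0.
Qed.

Lemma bump_ge0 N s : 0 <= bump N 0 s.
Proof. by rewrite exprn_ge0// cap_ge0. Qed.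

Lemma bump_le1 N s : bump N 0 s <= 1.
Proof. by rewrite exprn_ile1 ?cap_ge0 ?cap_le1. Qed.

Lemma bump0 N : bump N 0 0 = 1.
Proof. by rewrite /= /cap expr0n subr0 max_r// expr1n. Qed.

Lemma bump_nincr N s y : `|s| <= `|y| -> bump N 0 y <= bump N 0 s.
Proof.
move=> sy; rewrite lerXn2r ?nnegrE ?cap_ge0//.
rewrite /cap ge_max le_max lexx/= le_max; apply/orP; right.
by rewrite lerB// -(real_normK (num_real s)) -(real_normK (num_real y)) lerXn2r ?nnegrE.
Qed.

(** Up to second order every derivative keeps the factor [cap s ^+ N.+1]. As [cap s <= 1] and
    [N.+3%:R / p <= N.+1%:R], this factor is at most the power 1/p of [cap s ^+ N.+3]. The constant
    covers 4(N+3)^2 + 2(N+3), which bounds the coefficients of the second derivative. *)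
Lemma bump_le_powR N a (p : R) s : 0 < p -> N.+3%:R / p <= N.+1%:R ->
  `|bump N a s| <= (8 * N.+3%:R ^+ 2) * bump N 0 s `^ p^-1.
Proof.
move=> p0 Np.
have [s1|/ltW s1] := leP 1 `|s|.
  by rewrite bump_out// normr0 mulr_ge0 ?mulr_ge0 ?sqr_ge0 ?powR_ge0.
set c := 8 * _; have c0 : 0 <= c by rewrite mulr_ge0 ?sqr_ge0.
have n3 : 1 <= N.+3%:R :> R by rewrite ler1n.
have capX : cap s ^+ N.+1 <= bump N 0 s `^ p^-1.
  rewrite /= -!powR_mulrn ?cap_ge0// -powRrM.
  have := cap_ge0 s; rewrite le_eqVlt => /predU1P[<-|s0].
    by rewrite powR0 ?powR_ge0// pnatr_eq0.
  by apply: ger_powR; rewrite ?s0 ?cap_le1.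
apply: (@le_trans _ _ (c * cap s ^+ N.+1)); last by rewrite ler_wpM2l.
have C0 := cap_ge0 s.
have X0 := exprn_ge0 N.+1 (cap_ge0 s).
have XS : cap s ^+ N.+2 <= cap s ^+ N.+1.
  by rewrite exprS ler_piMl ?cap_le1.
have XSS : cap s ^+ N.+3 <= cap s ^+ N.+1.
  by apply: (le_trans _ XS); rewrite exprS ler_piMl ?cap_le1 ?exprn_ge0 ?cap_ge0.
have YS := exprn_ge0 N.+2 (cap_ge0 s).
have YSS := exprn_ge0 N.+3 (cap_ge0 s).
have N2 : N.+2%:R <= N.+3%:R :> R by rewrite ler_nat.
have N20 : 0 <= N.+2%:R :> R by [].
case: a => [|[|[|a]]] /=; last by rewrite normr0 mulr_ge0.
- rewrite ger0_norm//; apply: (le_trans XSS).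
  by rewrite ler_peMl// /c; nra.
- rewrite normrM normrN [`|2 * s|]normrM (ger0_norm (ler0n _ 2)).
  rewrite [`|_ * cap s ^+ _|]ger0_norm ?mulr_ge0//.
  apply: (@le_trans _ _ (N.+3%:R * cap s ^+ N.+1 * 2)).
    by apply: ler_pM; rewrite ?mulr_ge0// ?ler_wpM2l//; lra.
  by rewrite /c mulrAC ler_wpM2r//; nra.
- apply: (le_trans (ler_normB _ _)).
  rewrite [`|2 * _ * _|]ger0_norm ?mulr_ge0//.
  rewrite normrM normrX [`|2 * s|]normrM (ger0_norm (ler0n _ 2)).
  rewrite [`|_ * (_ * _)|]ger0_norm ?mulr_ge0//.
  have : (2 * `|s|) ^+ 2 <= 4 by have := normr_ge0 s; nra.
  move=> s4.
  apply: (@le_trans _ _ (N.+3%:R * (N.+3%:R * cap s ^+ N.+1) * 4 + 2 * N.+3%:R * cap s ^+ N.+1)).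
    apply: lerD; last by rewrite ler_wpM2l// mulr_ge0.
    apply: ler_pM; rewrite ?mulr_ge0 ?sqr_ge0//.
    by rewrite ler_wpM2l// ler_wpM2r.
  rewrite [X in X <= _](_ : _ = (N.+3%:R ^+ 2 * 4 + 2 * N.+3%:R) * cap s ^+ N.+1); last by ring.
  by rewrite /c ler_wpM2r//; nra.
Qed.

(** Here [1 - s ^+ 2] is at least 3/4, hence above 1/2. The bound makes the time integral of the
    cut-off grow at least linearly in T. *)
Lemma bump_half N s : `|s| <= 2^-1 -> 2^-1 ^+ N.+3 <= bump N 0 s.
Proof.
move=> s2; rewrite lerXn2r ?nnegrE ?cap_ge0 ?invr_ge0//.
rewrite /cap le_max; apply/orP; right.
by rewrite -(real_normK (num_real s)); have := normr_ge0 s; nra.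
Qed.

End profile.

(** * Products of rescaled profiles *)

Lemma is_derive_affine (R : realType) (h y c : R) :
  is_derive h 1 (fun t : R => y + t * c) c.
Proof.
rewrite (_ : (fun t => _) = cst y + c *: id).
  have := @is_deriveD R R R (cst y) (c *: id) h 1 0 (c *: 1)
    (is_derive_cst _ _ _) (is_deriveZ _ _).
  by rewrite add0r [c *: 1]mulr1; apply.
by apply/funext => t; rewrite mulrC.
Qed.

Section product_bump.
Variables (R : realType) (n N : nat) (r : 'I_n -> R).
Hypothesis r_gt0 : forall l, 0 < r l.
Local Notation Rn := 'rV[R]_n.
Implicit Types (x v : Rn) (a : 'I_n -> nat) (c : R).

(** A directional derivative sees only the restriction to a line, here a one-variable function after
    an affine map, so the chain rule applies. *)
Lemma is_derive_line (G : Rn -> R) x v (g : R -> R) (y c dg : R) :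
  is_derive y 1 g dg -> (forall h, G (h *: v + x) = g (y + h * c)) ->
  is_derive x v G (c * dg).
Proof.
move=> gd Gg; rewrite mulrC.
have H : is_derive (0 : R) 1 (fun h : R => G (h *: v + x)) (dg * c).
  rewrite (_ : (fun h => _) = g \o (fun t => y + t * c)); last exact/funext.
  apply: is_derive1_comp; last exact: is_derive_affine.
  by rewrite mul0r addr0.
apply: DeriveDef; first by apply/(derivable1P G x v); case: H.
case: H => _ <-; rewrite /derive.
set g1 := fun h => _; set g2 := fun h => _; suff -> : g1 = g2 by [].
by apply/funext => h; rewrite /g1 /g2 /= [h%:A]mulr1 addr0 scale0r add0r.
Qed.

(** For [a <= 2], this is the [a]-th derivative of the profile stretched to [-s, s]; each derivative
    costs a factor 1/s. *)
Definition sbump (s : R) (a : nat) (y : R) : R := s ^- a * bump N a (y / s).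

Lemma is_derive_sbump (s : R) (a : nat) (y : R) : (a < 2)%N ->
  is_derive y 1 (sbump s a) (sbump s a.+1 y).
Proof.
move=> a2.
have H : is_derive y 1 (bump N a \o (fun t => 0 + t / s)) (bump N a.+1 (y / s) * s^-1).
  apply: is_derive1_comp; last exact: is_derive_affine.
  by rewrite add0r; exact: is_derive_bump.
rewrite (_ : sbump s a = s ^- a *: (bump N a \o (fun t => 0 + t / s))).
  by apply: is_derive_eq; rewrite /sbump (exprSr s a) invfM -[_ *: _]/(_ * _); ring.
by apply/funext => t; rewrite /sbump -[t / s]add0r.
Qed.

Lemma continuous_sbump (s : R) (a : nat) : continuous (sbump s a).
Proof.
move=> y; apply: cvgM; first exact: cvg_cst.
apply: (@continuous_comp R R R (fun t => t / s) (bump N a)).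
  exact: mulrr_continuous.
exact: continuous_bump.
Qed.

(** With [a = count_mem ^~ s], the partial derivative [pderivs s] of
    [c * \prod_l sbump (r l) 0 (x_l)]. *)
Definition pbump c a : Rn -> R :=
  fun x => c * \prod_(l < n) sbump (r l) (a l) (x 0 l).

Definition incr a (i : 'I_n) : 'I_n -> nat := fun l => (a l + (i == l))%N.

Lemma pbump_line c a i (d h : R) x :
  pbump c a (h *: (d *: delta_mx 0 i) + x) =
  (c * \prod_(l < n | l != i) sbump (r l) (a l) (x 0 l)) *
  sbump (r i) (a i) (x 0 i + h * d).
Proof.
rewrite /pbump (bigD1 i)//= [_ * \prod_(l < n | _) _]mulrC mulrA; congr (_ * _ * _).
  apply: eq_bigr => l li; congr sbump.
  by rewrite !mxE eqxx (negPf li) !mulr0 add0r.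
by congr sbump; rewrite !mxE !eqxx mulr1 addrC.
Qed.

(** The direction carries a scalar [d] so that the lemma serves both the partial derivatives
    ([d = 1]) and the fields X_j, whose value at a point is a multiple of a basis vector. *)
Lemma is_derive_pbump c a i (d : R) x : (a i < 2)%N ->
  is_derive x (d *: delta_mx 0 i) (pbump c a) (d * pbump c (incr a i) x).
Proof.
move=> ai2.
set A := c * \prod_(l < n | l != i) sbump (r l) (a l) (x 0 l).
have H : is_derive (x 0 i) 1 (A *: sbump (r i) (a i)) (A * sbump (r i) (a i).+1 (x 0 i)).
  have ? := is_derive_sbump (r i) (x 0 i) ai2.
  by apply: is_derive_eq.
have -> : pbump c (incr a i) x = A * sbump (r i) (a i).+1 (x 0 i).
  (* With zero displacement, [pbump_line] just splits the [i]-th factor off the product. *)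
  have := pbump_line c (incr a i) i 0 0 x.
  rewrite scale0r add0r mulr0 addr0 /incr eqxx addn1 => ->; congr (_ * _ * _).
  by apply: eq_bigr => l; rewrite eq_sym => /negPf->; rewrite addn0.
by apply: (is_derive_line H) => h; exact: pbump_line.
Qed.

Lemma pderiv_pbump c a i : (a i < 2)%N ->
  pderiv i (pbump c a) = pbump c (incr a i).
Proof.
move=> ai2; apply/funext => x; rewrite /pderiv.
have [_ ] := is_derive_pbump c 1 x ai2.
by rewrite scale1r mul1r.
Qed.

Lemma derivable_pbump c a i x : (a i < 2)%N ->
  derivable (pbump c a) x (delta_mx 0 i).
Proof.
by move=> ai2; have [+ _] := is_derive_pbump c 1 x ai2; rewrite scale1r.
Qed.

Definition counts (s : seq 'I_n) : 'I_n -> nat := fun l => count_mem l s.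

Lemma counts_le s l : (counts s l <= size s)%N.
Proof. exact: count_size. Qed.

Lemma pderivs_pbump c s : (size s <= 2)%N ->
  pderivs s (pbump c (fun=> 0%N)) = pbump c (counts s).
Proof.
elim: s => [_|i s IH s2]; first by congr pbump; exact/funext.
rewrite [LHS]/= (IH (ltnW s2)) pderiv_pbump; last first.
  exact: (leq_ltn_trans (counts_le s i)).
by congr pbump; apply/funext => l; rewrite /counts/= addnC.
Qed.

Lemma continuous_pbump c a : continuous (pbump c a).
Proof.
move=> x; apply: (@continuousM R Rn (cst c)
  (fun x => \prod_(l < n) sbump (r l) (a l) (x 0 l)) x).
  exact: cst_continuous.
apply: (@continuous_big R 'I_n *%R 1 xpredT (@mul_continuous R)) => l _ {}x.
apply: (@continuous_comp Rn R R (fun x => x 0 l) (sbump (r l) (a l))).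
  exact: coord_continuous.
exact: continuous_sbump.
Qed.

Lemma is_Ck_pbump c : is_Ck 2 (pbump c (fun=> 0%N)).
Proof.
split=> [s i x s2|s s2].
  rewrite (pderivs_pbump _ (ltnW s2)); apply: derivable_pbump.
  exact: (leq_ltn_trans (counts_le s i)).
by rewrite (pderivs_pbump _ s2); exact: continuous_pbump.
Qed.

Lemma pbumpM c a x : pbump c a x = c * pbump 1 a x.
Proof. by rewrite /pbump mul1r. Qed.

Lemma pbump_out c a x : (exists l, r l < `|x 0 l|) -> pbump c a x = 0.
Proof.
move=> [l rl]; rewrite /pbump (bigD1 l)//= /sbump bump_out ?mulr0 ?mul0r ?mulr0//.
by rewrite normrM normfV (gtr0_norm (r_gt0 l)) ler_pdivlMr// mul1r ltW.
Qed.

Lemma pbump_ge0 c x : 0 <= c -> 0 <= pbump c (fun=> 0%N) x.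
Proof.
move=> c0; rewrite mulr_ge0//; apply: prodr_ge0 => l _.
by rewrite /sbump expr0 invr1 mul1r bump_ge0.
Qed.

Lemma pbump_le1 x : pbump 1 (fun=> 0%N) x <= 1.
Proof.
rewrite /pbump mul1r; apply: prodr_ile1 => l _.
by rewrite /sbump expr0 invr1 mul1r bump_ge0 bump_le1.
Qed.

Lemma measurable_pbump c a : measurable_fun setT (pbump c a).
Proof.
apply: measurable_funM; first exact: measurable_cst.
apply: measurable_prod => l _.
apply: measurableT_comp; last exact: measurable_coord.
by apply: continuous_measurable_fun; exact: continuous_sbump.
Qed.

(** [bump_le_powR] is applied in each coordinate: the power 1/p distributes over the nonnegative
    factors, and each derivative in x_l contributes 1 / r_l. *)
Lemma pbump_le_powR a x (p : R) : 0 < p -> N.+3%:R / p <= N.+1%:R ->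
  `|pbump 1 a x| <= (8 * N.+3%:R ^+ 2) ^+ n * \prod_(l < n) r l ^- a l *
    pbump 1 (fun=> 0%N) x `^ p^-1.
Proof.
move=> p0 Np; rewrite /pbump !mul1r normr_prod.
have powR_prod (s : seq 'I_n) (F : 'I_n -> R) : (forall l, 0 <= F l) ->
    (\prod_(l <- s) F l) `^ p^-1 = \prod_(l <- s) F l `^ p^-1.
  move=> F0; elim: s => [|l s IH]; first by rewrite !big_nil powR1.
  by rewrite !big_cons powRM ?IH// prodr_ge0.
rewrite powR_prod; last first.
  by move=> l; rewrite /sbump expr0 invr1 mul1r bump_ge0.
have -> : (8 * N.+3%:R ^+ 2) ^+ n = \prod_(l < n) (8 * N.+3%:R ^+ 2) :> R.
  by rewrite prodr_const card_ord.
rewrite -!big_split/=.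
apply: ler_prod => l _; rewrite normr_ge0/= /sbump expr0 invr1 mul1r.
have rl0 : 0 <= r l ^- a l by rewrite invr_ge0 exprn_ge0// ltW.
rewrite normrM ger0_norm// [_ * r l ^- _]mulrC -mulrA ler_wpM2l//.
exact: bump_le_powR.
Qed.

End product_bump.

(** * Test functions and their Laplacians *)

Section test_functions.
Variables (R : realType) (n N : nat) (r : 'I_n -> R).
Hypothesis r_gt0 : forall l, 0 < r l.
Local Notation Rn := 'rV[R]_n.
Implicit Types (x v : Rn) (c : R) (k : nat -> nat -> nat).
Local Notation a0 := (fun=> 0%N).

(** Agreement on a single line is enough. It allows a coefficient that is constant along [v], though
    not elsewhere, to be frozen at its value at [x]. *)
Lemma eq_line_is_derive (F G : Rn -> R) x v (df : R) :
  (forall h, G (h *: v + x) = F (h *: v + x)) ->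
  is_derive x v F df -> is_derive x v G df.
Proof.
move=> GF [dF <-]; have G0 : G x = F x by have := GF 0; rewrite scale0r add0r.
have E : (fun h => h^-1 *: ((G \o shift x) (h *: v) - G x)) =
         (fun h => h^-1 *: ((F \o shift x) (h *: v) - F x)).
  by apply/funext => h; rewrite /= GF G0.
by apply: DeriveDef; rewrite /derivable /derive E.
Qed.

Lemma is_derive_cvg_dnbhs (g : R -> R) (t dg : R) : is_derive t 1 g dg ->
  (s - t)^-1 * (g s - g t) @[s --> t^'] --> dg.
Proof.
move=> [gd <-].
have st : (fun s => s - t) @ t^' --> (0 : R)^'.
  move=> A /nbhs_ballP[e /= e0 H]; apply/nbhs_ballP; exists e => //= s.
  rewrite /ball /= => ts st; apply: H; last by rewrite subr_eq0.
  by rewrite /ball /= sub0r opprB.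
have := @cvg_comp _ _ _ (fun s => s - t)
  (fun h => h^-1 *: ((g \o shift t) (h *: 1) - g t)) _ _ _ st gd.
apply: cvg_trans; apply: near_eq_cvg; apply: nearW => s /=.
by rewrite [(s - t)%:A]mulr1 subrK.
Qed.

Lemma pbump_bounded (a : 'I_n -> nat) :
  exists M : R, forall x, `|pbump N r 1 a x| <= M.
Proof.
exists ((8 * N.+3%:R ^+ 2) ^+ n * \prod_(l < n) r l ^- a l) => x.
(* The exponent 3 is a convenient choice: (N+3)/3 <= N+1 holds for every N, and the remaining power
   of the bump is at most 1. *)
have p3 : 0 < 3 :> R by [].
have Np : N.+3%:R / 3 <= N.+1%:R :> R.
  by rewrite ler_pdivrMr// -natrM ler_nat mulSn mulnC; lia.
apply: (le_trans (pbump_le_powR r_gt0 a x p3 Np)).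
rewrite ler_piMr//.
  rewrite mulr_ge0 ?exprn_ge0 ?mulr_ge0 ?sqr_ge0//.
  by apply: prodr_ge0 => l _; rewrite invr_ge0 exprn_ge0 ?ltW.
rewrite -[leRHS](congr1 (@^~ 3^-1) (powR1 R)); apply: ge0_ler_powR;
  rewrite ?nnegrE ?invr_ge0 ?ler01 ?pbump_ge0//.
exact: pbump_le1.
Qed.

(** Time enters only through a scalar factor, so C^2 convergence follows from convergence of the
    scalars and boundedness of the space derivatives. Dividing [e] by [M + 1] avoids a zero
    denominator. *)
Lemma C2_cvg_pbump (F : set_system R) (FF : Filter F) (c : R -> R) (l : R) :
  c t @[t --> F] --> l ->
  C2_cvg F (fun t => pbump N r (c t) a0) (pbump N r l a0).
Proof.
move=> cl s s2 e e0; have [M HM] := pbump_bounded (counts s).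
have M0 : 0 <= M := le_trans (normr_ge0 _) (HM 0).
have M1 : 0 < M + 1 by rewrite ltr_wpDl.
move/cvgrPdist_le : cl => /(_ (e / (M + 1))); rewrite divr_gt0// => /(_ isT).
apply: filterS => t ht x.
rewrite !(pderivs_pbump _ _ _ s2) pbumpM [X in _ - X]pbumpM -mulrBl normrM distrC.
apply: (@le_trans _ _ (e / (M + 1) * (M + 1))); last by rewrite divfK ?gt_eqF.
by rewrite ler_pM// (le_trans (HM x))// lerDl.
Qed.

Lemma compact_box : compact [set x : Rn | forall l, `|x 0 l| <= r l].
Proof.
have := @rV_compact R n (fun l => [set` `[- r l, r l]]).
rewrite (_ : [set v : Rn | forall l, [set` `[- r l, r l]] (v 0 l)] =
             [set x : Rn | forall l, `|x 0 l| <= r l]).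
  by apply; move=> l; exact: segment_compact.
by apply/seteqP; split => x /= H l; have := H l; rewrite /= in_itv/= ler_norml.
Qed.

Lemma test_function_pbump (T : R) : 0 < T ->
  test_function +oo (fun t => pbump N r (sbump N T 0 t) a0).
Proof.
move=> T0; split; [|split; [|split]].
- exists T; first exact: ltry.
  move=> t [t0 _] Tt x; rewrite pbumpM /sbump bump_out ?mulr0 ?mul0r//.
  rewrite ger0_norm; last by rewrite divr_ge0// ltW.
  by rewrite ler_pdivlMr// mul1r ltW.
- exists [set x : Rn | forall l, `|x 0 l| <= r l]; first exact: compact_box.
  move=> t _ x xK; rewrite pbump_out//; apply: contrapT => H; apply: xK => l.
  by rewrite leNgt; apply/negP => rl; apply: H; exists l.
- by move=> t _; exact: is_Ck_pbump.
(* The time derivative acts on the scalar coefficient alone, and the difference quotients of psi are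
   again bumps with a scalar coefficient. *)
- exists (fun t => pbump N r (sbump N T 1 t) a0) => t _; split.
  + exact: is_Ck_pbump.
  + have -> : (fun (s : R) (x : Rn) => (s - t)^-1 *
        (pbump N r (sbump N T 0 s) a0 x - pbump N r (sbump N T 0 t) a0 x)) =
        fun s => pbump N r ((s - t)^-1 * (sbump N T 0 s - sbump N T 0 t)) a0.
      apply/funext => s; apply/funext => x.
      by rewrite /pbump -mulrBl mulrA.
    apply: C2_cvg_pbump; apply: cvg_within_filter.
    exact: (is_derive_cvg_dnbhs (is_derive_sbump _ _ _ _)).
  + apply: C2_cvg_pbump; apply: cvg_within_filter; exact: continuous_sbump.
Qed.

Definition weight k (j : 'I_n) (x : Rn) : R :=
  \prod_(l < n | (l < j)%N) x 0 l ^+ k j.+1 l.+1.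

Lemma weight_line k j h (d : R) x :
  weight k j (h *: (d *: delta_mx 0 j) + x) = weight k j x.
Proof.
apply: eq_bigr => l lj; congr (_ ^+ _); rewrite !mxE eqxx.
by rewrite -val_eqE/= (ltn_eqF lj) !mulr0 add0r.
Qed.

(** The only nonzero component of X_j is the [j]-th, and its coefficient contains only the variables
    x_l with l < j. *)
Lemma vf_div_monomial k j x : vf_div (monomial_vf k j) x = 0.
Proof.
rewrite /vf_div big1// => i _; rewrite /pderiv.
have [ij|ij] := eqVneq i j.
  subst i; suff [_ //] : is_derive x (delta_mx 0 j)
    (fun y : Rn => monomial_vf k j y 0 j) 0.
  apply: (@eq_line_is_derive (cst (weight k j x))) => h.
  rewrite /monomial_vf !mxE !eqxx mulr1.
  by have := weight_line k j h 1 x; rewrite scale1r.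
rewrite (_ : (fun y => _) = cst 0) ?derive_cst//.
by apply/funext => y; rewrite !mxE eqxx (negPf ij) mulr0.
Qed.

(** Zero divergence turns the adjoint into -X_j, and the coefficient of X_j is constant along X_j,
    so X_j^2 is the squared coefficient times the second derivative in x_j. *)
Lemma vf_laplacian_pbump k c x :
  vf_laplacian (monomial_vf k) (pbump N r c a0) x =
  \sum_(j < n) weight k j x ^+ 2 * pbump N r c (incr (incr a0 j) j) x.
Proof.
rewrite /vf_laplacian -sumrN; apply: eq_bigr => j _.
rewrite /vf_adjoint vf_div_monomial mul0r subr0 opprK.
have -> : vf_apply (monomial_vf k j) (pbump N r c a0) =
    fun y => weight k j y * pbump N r c (incr a0 j) y.
  apply/funext => y; rewrite /vf_apply /monomial_vf.
  by have [_ ->] := is_derive_pbump N r c (a := a0) (i := j) (weight k j y) y (isT : (0 < 2)%N).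
rewrite /vf_apply.
suff [_ ->] : is_derive x (monomial_vf k j x)
  (fun y => weight k j y * pbump N r c (incr a0 j) y)
  (weight k j x ^+ 2 * pbump N r c (incr (incr a0 j) j) x) by [].
apply: (@eq_line_is_derive (weight k j x *: pbump N r c (incr a0 j))).
  by move=> h; rewrite weight_line.
have i1 : (incr a0 j j < 2)%N by rewrite /incr eqxx.
have ? := is_derive_pbump N r c (weight k j x) x i1.
by apply: is_derive_eq; rewrite /GRing.scale /= mulrA expr2.
Qed.

End test_functions.

(** * Iterated integrals *)

Section iterated_integral.
Context d1 d2 (T1 : measurableType d1) (T2 : measurableType d2) (R : realType).
Variables (m1 : {measure set T1 -> \bar R})
          (m2 : {sigma_finite_measure set T2 -> \bar R}).
Variables (D : set T1) (mD : measurable D).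
Implicit Types F G : T1 -> T2 -> R.

Local Notation meas F :=
  (measurable_fun (D `*` [set: T2]) (fun z : T1 * T2 => F z.1 z.2)).

Lemma measurable_section F : meas F ->
  forall t, D t -> measurable_fun setT (F t).
Proof.
move=> mF t Dt; apply: (@measurable_comp _ _ _ _ _ _ (D `*` [set: T2])
  (fun z : T1 * T2 => F z.1 z.2) setT (pair t)) => //.
- exact: measurableX.
- by move=> _ [x _ <-].
Qed.

(** After extension by zero outside [D], the Tonelli measurability statement is applied to the
    positive and the negative part separately. *)
Lemma measurable_integral_section F : meas F ->
  measurable_fun D (fun t => \int[m2]_x (F t x)%:E)%E.
Proof.
move=> mF; pose g := ((EFin \o (fun z : T1 * T2 => F z.1 z.2)) \_ (D `*` setT))%E.
have mDX : measurable (D `*` [set: T2]) by exact: measurableX.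
have mg : measurable_fun setT g.
  by apply/(measurable_restrictT _ mDX)/measurable_EFinP.
have mp : measurable_fun setT (g^\+)%E by exact: measurable_funepos.
have mn : measurable_fun setT (g^\-)%E by exact: measurable_funeneg.
apply: (@eq_measurable_fun _ _ _ _ D
  (fun t => fubini_F m2 (g^\+)%E t - fubini_F m2 (g^\-)%E t)%E).
  move=> t; rewrite inE => Dt; rewrite integralE /fubini_F; congr (_ - _)%E;
  by apply: eq_integral => x _; rewrite ?funeposE ?funenegE /g /patch /= mem_set.
apply: measurable_funTS; apply: emeasurable_funB.
  exact: measurable_fun_fubini_tonelli_F.
exact: measurable_fun_fubini_tonelli_F.
Qed.

Lemma iterated_ge0 F : (forall t x, D t -> 0 <= F t x) ->
  (0 <= \int[m1]_(t in D) \int[m2]_x (F t x)%:E)%E.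
Proof.
by move=> F0; apply: integral_ge0 => t Dt; apply: integral_ge0 => x _; rewrite lee_fin F0.
Qed.

(** The triangle inequality for integrals is used first in t, then in x. The inequality is between
    extended reals, so the right-hand side may be infinite. *)
Lemma le_abse_iterated F G : meas F -> meas G ->
  (forall t x, D t -> `|F t x| <= G t x) ->
  (`|\int[m1]_(t in D) \int[m2]_x (F t x)%:E| <=
   \int[m1]_(t in D) \int[m2]_x (G t x)%:E)%E.
Proof.
move=> mF mG FG.
apply: (le_trans (le_abse_integral m1 mD (measurable_integral_section mF))).
apply: ge0_le_integral => //.
- by apply: measurableT_comp => //; exact: measurable_integral_section.
- exact: measurable_integral_section.
move=> t Dt; have mFt := measurable_section mF Dt.
have mGt := measurable_section mG Dt.
apply: (le_trans (le_abse_integral m2 measurableT _)); first exact/measurable_EFinP.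
apply: ge0_le_integral => //.
- by apply: measurableT_comp => //; exact/measurable_EFinP.
- exact/measurable_EFinP.
- by move=> x _; rewrite lee_fin FG.
Qed.

Lemma iteratedD F G : meas F -> meas G ->
  (forall t x, D t -> 0 <= F t x) -> (forall t x, D t -> 0 <= G t x) ->
  (\int[m1]_(t in D) \int[m2]_x (F t x + G t x)%:E =
   \int[m1]_(t in D) \int[m2]_x (F t x)%:E +
   \int[m1]_(t in D) \int[m2]_x (G t x)%:E)%E.
Proof.
move=> mF mG F0 G0; rewrite -ge0_integralD//; last 4 first.
- by move=> t Dt; apply: integral_ge0 => x _; rewrite lee_fin F0.
- exact: measurable_integral_section.
- by move=> t Dt; apply: integral_ge0 => x _; rewrite lee_fin G0.
- exact: measurable_integral_section.
apply: eq_integral => t; rewrite inE => Dt.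
under eq_integral do rewrite EFinD.
rewrite ge0_integralD//.
- by move=> x _; rewrite lee_fin F0.
- by apply/measurable_EFinP; exact: measurable_section Dt.
- by move=> x _; rewrite lee_fin G0.
- by apply/measurable_EFinP; exact: measurable_section Dt.
Qed.

Lemma iteratedZl F (c : R) : meas F -> 0 <= c ->
  (forall t x, D t -> 0 <= F t x) ->
  (\int[m1]_(t in D) \int[m2]_x (c * F t x)%:E =
   c%:E * \int[m1]_(t in D) \int[m2]_x (F t x)%:E)%E.
Proof.
move=> mF c0 F0; rewrite -ge0_integralZl//; last 2 first.
- exact: measurable_integral_section.
- by move=> t Dt; apply: integral_ge0 => x _; rewrite lee_fin F0.
apply: eq_integral => t; rewrite inE => Dt.
under eq_integral do rewrite EFinM.
rewrite ge0_integralZl//.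
- by apply/measurable_EFinP; exact: measurable_section Dt.
- by move=> x _; rewrite lee_fin F0.
Qed.

End iterated_integral.

(** * Homogeneous degrees *)

Definition hom_degree (k : nat -> nat -> nat) (j : nat) : nat :=
  (1 + \sum_(1 <= i < j) nested_sum k j i)%N.

(** The outermost index would have to satisfy i <= l < j. These zeros allow summation ranges in i
    and l to be enlarged or cut. *)
Lemma nested_sum_eq0 k j i : (0 < j <= i)%N -> nested_sum k j i = 0%N.
Proof.
case: i => [|i] /andP[j0 ji]; first by move: j0; rewrite ltnNge ji.
by rewrite /= big_geq.
Qed.

(** [hom_degree k j] is the weight of [x_j] in the dilations for which all the
    fields [monomial_vf k] are homogeneous of degree 1. *)
Lemma hom_degree_rec k j :
  hom_degree k j = (1 + \sum_(1 <= l < j) k j l * hom_degree k l)%N.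
Proof.
congr addn.
(* The inner range i <= l < j is enlarged by vanishing terms to 1 <= l < j; it no longer depends on
   i, so the two sums can be exchanged. *)
transitivity (\sum_(1 <= i < j) \sum_(1 <= l < j) k j l * nested_sum k l i.-1)%N.
  rewrite big_nat_cond [RHS]big_nat_cond; apply: eq_bigr => i /andP[/andP[i1 ij] _].
  case: i i1 ij => // i _ ij; rewrite /= [RHS](@big_cat_nat _ _ _ i.+1)/= ?(ltnW ij)//.
  suff -> : (\sum_(1 <= l < i.+1) k j l * nested_sum k l i = 0)%N by [].
  rewrite big_nat_cond big1// => l /andP[/andP[l1 li] _].
  by rewrite nested_sum_eq0 ?muln0// l1 -ltnS.
rewrite exchange_big big_nat_cond [RHS]big_nat_cond; apply: eq_bigr => l /andP[/andP[l1 lj] _].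
rewrite -big_distrr/=; congr muln.
(* For fixed l the shifted index i-1 starts at 0, where the convention R_{l,0} = 1 supplies the
   leading 1 of [hom_degree k l]; the terms from l on vanish. *)
case: j lj => // j lj; rewrite big_add1/= /hom_degree.
rewrite (@big_cat_nat _ _ _ l)//=.
suff -> : (\sum_(l <= i < j) nested_sum k l i = 0)%N.
  by rewrite addn0 big_ltn.
rewrite big_nat_cond big1// => i /andP[/andP[li _] _].
by rewrite nested_sum_eq0 ?l1.
Qed.

(** Identifies the homogeneous dimension Q of the dilations with the quantity in the bound on p. The
    coordinate x_1 has degree 1, so the double sum can start at j = 2. *)
Lemma sum_hom_degree k n :
  (\sum_(l < n) hom_degree k l.+1)%N = (n + total_nested_sum k n)%N.
Proof.
rewrite /hom_degree big_split/= sum1_card card_ord; congr addn.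
rewrite /total_nested_sum; case: n => [|n]; first by rewrite big_ord0 big_geq.
rewrite big_ord_recl/= big_geq// add0n big_add1/= big_add1/= big_mkord.
by apply: eq_bigr.
Qed.

(** * Anisotropic boxes and bumps *)

Section anisotropic_bump.
Variables (R : realType) (n : nat) (k : nat -> nat -> nat) (N : nat) (p rho : R).
Hypotheses (p_gt1 : 1 < p) (Np : N.+3%:R / p <= N.+1%:R) (rho_ge1 : 1 <= rho).
Local Notation Rn := 'rV[R]_n.
Local Notation a0 := (fun=> 0%N).
Implicit Types (x : Rn) (c t T : R).

(** Half-widths of the image of the cube [-1, 1]^n under the dilation with parameter [rho]. *)
Definition anis (l : 'I_n) : R := rho ^+ hom_degree k l.+1.

Lemma rho_gt0 : 0 < rho. Proof. exact: lt_le_trans rho_ge1. Qed.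

Lemma anis_gt0 l : 0 < anis l. Proof. by rewrite exprn_gt0// rho_gt0. Qed.

Local Notation phi := (pbump N anis 1 a0).

(** On the box the monomial is at most [rho] to the sum of k_{j,l} sigma_l, and by [hom_degree_rec]
    this exponent is sigma_j - 1. *)
Lemma weight_le x (j : 'I_n) : (forall l, `|x 0 l| <= anis l) ->
  `|weight k j x| * rho <= anis j.
Proof.
move=> xr; rewrite /anis hom_degree_rec add1n exprSr ler_wpM2r ?(ltW rho_gt0)//.
rewrite /weight normr_prod.
have -> : (\sum_(1 <= l < j.+1) k j.+1 l * hom_degree k l =
    \sum_(l < n | (l < j)%N) hom_degree k l.+1 * k j.+1 l.+1)%N.
  rewrite big_add1/= big_mkord.
  rewrite (big_ord_widen n (fun l => k j.+1 l.+1 * hom_degree k l.+1)%N (ltnW (ltn_ord j))).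
  by apply: eq_bigr => l _; rewrite mulnC.
rewrite -prodrXr; apply: ler_prod => l _; rewrite normr_ge0/= normrX exprM.
by rewrite lerXn2r ?nnegrE ?exprn_ge0 ?(ltW rho_gt0)//; exact: xr.
Qed.

Definition bump_cst : R := 8 * N.+3%:R ^+ 2.

Lemma bump_cst_ge0 : 0 <= bump_cst.
Proof. by rewrite mulr_ge0 ?sqr_ge0. Qed.

(** Inside the box the squared coefficient of X_j is at most (r_j / rho)^2, while two derivatives in
    x_j cost r_j^-2; what is left is rho^-2 for each of the n fields. Outside the box everything
    vanishes. *)
Lemma laplacian_pbump_le c x : 0 <= c ->
  `|vf_laplacian (monomial_vf k) (pbump N anis c a0) x| <=
  n%:R * bump_cst ^+ n / rho ^+ 2 * (c * phi x `^ p^-1).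
Proof.
move=> c0; rewrite vf_laplacian_pbump.
have -> : n%:R * bump_cst ^+ n / rho ^+ 2 * (c * phi x `^ p^-1) =
    \sum_(j < n) (bump_cst ^+ n / rho ^+ 2 * (c * phi x `^ p^-1)).
  by rewrite sumr_const card_ord -[RHS]mulr_natl !mulrA.
apply: (le_trans (ler_norm_sum _ _ _)); apply: ler_sum => j _.
have R0 : 0 <= bump_cst ^+ n / rho ^+ 2 * (c * phi x `^ p^-1).
  by rewrite !mulr_ge0 ?powR_ge0 ?exprn_ge0 ?bump_cst_ge0 ?invr_ge0 ?exprn_ge0 ?(ltW rho_gt0).
have [[l xl]|H] := pselect (exists l, anis l < `|x 0 l|).
  by rewrite (pbump_out N anis_gt0 _ _ (ex_intro _ l xl)) mulr0 normr0.
have xr l : `|x 0 l| <= anis l.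
  by rewrite leNgt; apply/negP => xl; apply: H; exists l.
rewrite pbumpM normrM [`|c * _|]normrM (ger0_norm c0).
have p0 : 0 < p by exact: lt_trans p_gt1.
have := pbump_le_powR anis_gt0 (incr (incr a0 j) j) x p0 Np.
rewrite -/bump_cst (bigD1 j)//= big1 => [|l lj]; last first.
  by rewrite /incr eq_sym (negPf lj) expr0 invr1.
rewrite /incr eqxx mulr1 => H1.
have w2 : `|weight k j x ^+ 2| * anis j ^- 2 <= rho ^- 2.
  have a20 : 0 < anis j ^+ 2 by rewrite exprn_gt0// anis_gt0.
  have r20 : 0 < rho ^+ 2 by rewrite exprn_gt0// rho_gt0.
  rewrite normrX ler_pdivrMr// mulrC ler_pdivlMr// -exprMn.
  rewrite lerXn2r ?nnegrE ?weight_le//; last exact: ltW (anis_gt0 j).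
  by rewrite mulr_ge0 ?(ltW rho_gt0).
apply: (@le_trans _ _ (`|weight k j x ^+ 2| * (c *
    (bump_cst ^+ n * anis j ^- 2 * phi x `^ p^-1)))).
  by rewrite ler_wpM2l// ler_wpM2l.
rewrite [leLHS](_ : _ = `|weight k j x ^+ 2| * anis j ^- 2 *
    (bump_cst ^+ n * (c * phi x `^ p^-1))); last by ring.
rewrite [leRHS](_ : _ = rho ^- 2 * (bump_cst ^+ n * (c * phi x `^ p^-1))); last by ring.
by rewrite ler_wpM2r// !mulr_ge0 ?powR_ge0 ?exprn_ge0 ?bump_cst_ge0.
Qed.

Definition box : set Rn := [set x | forall l, `|x 0 l| <= anis l].

Lemma phi_out x : ~ box x -> phi x = 0.
Proof.
move=> xb; apply: (pbump_out _ anis_gt0); apply: contrapT => H; apply: xb => l.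
by rewrite leNgt; apply/negP => rl; apply: H; exists l.
Qed.

Lemma box_itv : box = [set x : Rn | forall l, [set` `[- anis l, anis l]] (x 0 l)].
Proof.
by apply/seteqP; split => x /= H l; have := H l; rewrite in_itv/= ler_norml.
Qed.

Lemma measurable_box : measurable box.
Proof.
rewrite box_itv (_ : mkset _ = \bigcap_(l in [set: 'I_n])
    ((fun x : Rn => x 0 l) @^-1` [set` `[- anis l, anis l]])).
  apply: fin_bigcap_measurable => // l _.
  by rewrite -[X in measurable X]setTI; exact: measurable_coord.
by apply/seteqP; split=> x /= H l; [move=> _|]; exact: H.
Qed.

Definition box_volume : R := 2 ^+ n * rho ^+ (n + total_nested_sum k n).

Lemma lebesgue_box : lebesgue_row R n box = box_volume%:E.
Proof.
rewrite box_itv (@lebesgue_row_box R n (fun l => [set` `[- anis l, anis l]]))//.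
rewrite (eq_bigr (fun l => (2 * anis l)%:E)) => [|l _]; last first.
  rewrite lebesgue_measure_itv/= lte_fin gtrN ?anis_gt0//.
  by rewrite -EFinB opprK mulr_natl mulr2n.
rewrite prodEFin; congr _%:E; rewrite big_split/= prodr_const card_ord.
by rewrite /box_volume -sum_hom_degree prodrXr.
Qed.

Lemma box_volume_ge0 : 0 <= box_volume.
Proof. by rewrite mulr_ge0 ?exprn_ge0 ?(ltW rho_gt0). Qed.

End anisotropic_bump.

(** * The a priori inequality *)

(** Young's inequality for A w^(1/p) and B, with the factors 1/p and 1/q bounded by 1. The prefactor
    1/2 lets the two terms in u each absorb half of the integral of |u|^p psi. The function [chi]
    localises the remainder to the support of [w]. *)
Lemma young_half (R : realType) (p q A b B w chi : R) :
  1 < p -> 1 < q -> p^-1 + q^-1 = 1 -> 0 <= A -> 0 <= b -> 0 <= B -> 0 <= w ->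
  b <= B / 2 * w `^ p^-1 -> 0 <= chi -> (w != 0 -> chi = 1) ->
  A * b <= 2^-1 * (A `^ p * w + B `^ q * chi).
Proof.
move=> p1 q1 pq A0 b0 B0 w0 bB chi0 wchi.
have p0 : 0 < p by exact: lt_trans p1.
have q0 : 0 < q by exact: lt_trans q1.
have [wE|wN] := eqVneq w 0.
  move: bB; rewrite wE powR0 ?invr_eq0 ?gt_eqF// !mulr0 => b00.
  have -> : b = 0 by apply/eqP; rewrite eq_le b00.
  by rewrite mulr0 add0r mulr_ge0// mulr_ge0// powR_ge0.
rewrite (wchi wN) mulr1.
have ww : (w `^ p^-1) `^ p = w by rewrite -powRrM mulVf ?gt_eqF// powRr1.
apply: (@le_trans _ _ (2^-1 * ((A * w `^ p^-1) * B))).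
  rewrite [leRHS](_ : _ = A * (B / 2 * w `^ p^-1)); last by ring.
  by rewrite ler_wpM2l.
rewrite ler_wpM2l//.
apply: (le_trans (conjugate_powR (mulr_ge0 A0 (powR_ge0 _ _)) B0 p0 q0 pq)).
rewrite powRM ?powR_ge0// ww lerD//.
  by rewrite ler_piMr ?mulr_ge0 ?powR_ge0// invf_le1// ltW.
by rewrite ler_piMr ?powR_ge0// invf_le1// ltW.
Qed.

(** A finite sum of extended reals has finite terms, so [a], the integral of |u|^p psi, can be
    cancelled against the two halves bounding [d] and [e]. *)
Lemma sum5_eq0_le (R : realType) (a b c d e : \bar R) (c0 x y : R) :
  (a + b + c + d + e = 0 -> 0 <= a -> c0%:E <= c ->
  `|d| <= (2^-1)%:E * (a + x%:E) -> `|e| <= (2^-1)%:E * (a + y%:E) ->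
  (fine b + c0 <= 2^-1 * (x + y))%R)%E.
Proof.
move=> abc; have : (a + b + c + d + e)%E \is a fin_num by rewrite abc.
rewrite !fin_numD => /andP[/andP[/andP[/andP[]]]].
case: a abc => // a abc _; case: b abc => // b abc _; case: c abc => // c abc _.
case: d abc => // d abc _; case: e abc => // e abc _.
move: abc => [abc]; rewrite -!EFinD -!EFinM !lee_fin => a0 cc.
rewrite !ler_norml => /andP[d1 _] /andP[e1 _]; rewrite /fine; lra.
Qed.

Section main_inequality.
Variables (R : realType) (n : nat) (k : nat -> nat -> nat) (N : nat).
Variables (p q rho T : R).
Hypotheses (p_gt1 : 1 < p) (q_gt1 : 1 < q) (pq : p^-1 + q^-1 = 1).
Hypotheses (Np : N.+3%:R / p <= N.+1%:R) (rho_ge1 : 1 <= rho) (T_gt0 : 0 < T).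
Local Notation Rn := 'rV[R]_n.
Local Notation a0 := (fun=> 0%N).
Local Notation leb1 := (@lebesgue_measure R).
Local Notation lebn := (lebesgue_row R n).
Local Notation r := (@anis R n k rho).
Local Notation phi := (pbump N r 1 a0).
Local Notation psi t := (pbump N r (sbump N T 0 t) a0).
Local Notation I := (`]0, +oo[%classic : set R).
Local Notation meas F :=
  (measurable_fun (I `*` [set: Rn]) (fun z : R * Rn => F z.1 z.2)).
Implicit Types (x : Rn) (t : R) (u : R -> Rn -> R) (f : Rn -> R).

Let p_gt0 : 0 < p. Proof. exact: lt_trans p_gt1. Qed.
Let pV_le1 : p^-1 <= 1. Proof. by rewrite invf_le1// ltW. Qed.
Let r_gt0 : forall l, 0 < r l. Proof. exact: anis_gt0. Qed.
Let K := bump_cst R N.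

Let le_powR_pV (y : R) : 0 <= y <= 1 -> y <= y `^ p^-1.
Proof.
move=> /andP[]; rewrite le_eqVlt => /predU1P[<-|y0] y1; first exact: powR_ge0.
by apply: ger1_powR; rewrite ?y0.
Qed.

Let eta_bound t : 0 <= sbump N T 0 t <= 1.
Proof. by rewrite /sbump expr0 invr1 mul1r bump_ge0 bump_le1. Qed.

Let phi_bound x : 0 <= phi x <= 1.
Proof. by rewrite pbump_ge0// pbump_le1. Qed.

Let psiE t x : psi t x = sbump N T 0 t * phi x.
Proof. exact: pbumpM. Qed.

Lemma psi_ge0 t x : 0 <= psi t x.
Proof. by rewrite pbump_ge0//; case/andP: (eta_bound t). Qed.

Let psi_powR t x :
  psi t x `^ p^-1 = sbump N T 0 t `^ p^-1 * phi x `^ p^-1.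
Proof.
by rewrite psiE powRM//; [case/andP: (eta_bound t)|case/andP: (phi_bound x)].
Qed.

Lemma derive_psi t x : 'D_1 (fun s => psi s x) t = sbump N T 1 t * phi x.
Proof.
have -> : (fun s => psi s x) = phi x *: sbump N T 0.
  by apply/funext => s; rewrite psiE mulrC.
have [d0 d1] := @is_derive_sbump R N T 0 t isT.
by rewrite deriveZ// d1 mulrC.
Qed.

Lemma derive_psi_le t x : `|'D_1 (fun s => psi s x) t| <= K / T * psi t x `^ p^-1.
Proof.
rewrite derive_psi psi_powR normrM.
have phi_le : `|phi x| <= phi x `^ p^-1.
  by rewrite ger0_norm ?le_powR_pV//; case/andP: (phi_bound x).
have := @bump_le_powR R N 1 p (t / T) p_gt0 Np; rewrite -/(bump_cst R N) -/K => H.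
rewrite mulrA; apply: ler_pM => //.
rewrite /sbump expr1 expr0 invr1 mul1r normrM ger0_norm ?invr_ge0 ?(ltW T_gt0)//.
by rewrite [K / T]mulrC -mulrA ler_wpM2l ?invr_ge0 ?(ltW T_gt0).
Qed.

Lemma laplacian_psi_le t x :
  `|vf_laplacian (monomial_vf k) (psi t) x| <=
  n%:R * K ^+ n / rho ^+ 2 * psi t x `^ p^-1.
Proof.
have /andP[e0 e1] := eta_bound t.
apply: (le_trans (laplacian_pbump_le _ p_gt1 Np rho_ge1 _ e0)).
rewrite psi_powR ler_wpM2l ?mulr_ge0 ?exprn_ge0 ?bump_cst_ge0 ?invr_ge0 ?exprn_ge0//.
  by rewrite (le_trans _ rho_ge1).
by rewrite ler_wpM2r ?powR_ge0// le_powR_pV ?e0.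
Qed.

(** For positive times this is 1 wherever psi is nonzero, which is the role of [chi] in
    [young_half]. *)
Let chi t x : R := (t <= T)%R%:R * \1_(box k rho) x.

Let psi_chi t x : 0 < t -> psi t x != 0 -> chi t x = 1.
Proof.
move=> t0; rewrite psiE mulf_eq0 negb_or => /andP[eN fN]; rewrite /chi.
have -> : t <= T.
  rewrite leNgt; apply/negP => Tt; move: eN; rewrite /sbump bump_out ?mulr0 ?eqxx//.
  by rewrite ger0_norm ?divr_ge0 ?(ltW T_gt0) ?(ltW t0)// ler_pdivlMr// mul1r ltW.
rewrite indicE mem_set ?mul1r//; apply: contrapT => /(phi_out N rho_ge1) fx.
by rewrite fx eqxx in fN.
Qed.

Let measI : measurable I. Proof. exact: measurable_itv. Qed.

Lemma meas_fst (g : R -> R) : measurable_fun setT g -> meas (fun t (x : Rn) => g t).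
Proof.
by move=> mg; apply: measurable_funTS; apply: measurableT_comp => //; exact: measurable_fst.
Qed.

Lemma meas_snd (g : Rn -> R) : measurable_fun setT g -> meas (fun (t : R) x => g x).
Proof.
by move=> mg; apply: measurable_funTS; apply: measurableT_comp => //; exact: measurable_snd.
Qed.

Let meas_sbump a : meas (fun t (x : Rn) => sbump N T a t).
Proof. by apply: meas_fst; apply: continuous_measurable_fun; exact: continuous_sbump. Qed.

Let meas_pbump a b : meas (fun t x => pbump N r (sbump N T a t) b x).
Proof.
rewrite (_ : (fun z : R * Rn => _) =
  (fun z => sbump N T a z.1 * pbump N r 1 b z.2)); last first.
  by apply/funext => z; rewrite pbumpM.
by apply: measurable_funM; [exact: meas_sbump|apply: meas_snd; exact: measurable_pbump].
Qed.

Lemma measurable_weight j : measurable_fun setT (@weight R n k j).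
Proof.
rewrite /weight; under eq_fun do rewrite -big_filter.
apply: measurable_prod => l _; apply: measurable_funX; exact: measurable_coord.
Qed.

Let meas_laplacian : meas (fun t x => vf_laplacian (monomial_vf k) (psi t) x).
Proof.
rewrite (_ : (fun z : R * Rn => _) = (fun z => \sum_(j < n)
  weight k j z.2 ^+ 2 * pbump N r (sbump N T 0 z.1) (incr (incr a0 j) j) z.2)).
  apply: measurable_sum => j; apply: measurable_funM; last exact: meas_pbump.
  apply: measurable_funX; apply: meas_snd; exact: measurable_weight.
by apply/funext => z; rewrite vf_laplacian_pbump.
Qed.

Let meas_derive : meas (fun t x => 'D_1 (fun s => psi s x) t).
Proof.
rewrite (_ : (fun z : R * Rn => _) = (fun z => sbump N T 1 z.1 * phi z.2)).
  by apply: measurable_funM; [exact: meas_sbump|apply: meas_snd; exact: measurable_pbump].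
by apply/funext => z; rewrite derive_psi.
Qed.

Let meas_chi : meas chi.
Proof.
apply: (@measurable_funM _ _ _ _ (fun z : R * Rn => (z.1 <= T)%R%:R)
  (fun z => \1_(box k rho) z.2)).
  apply: (meas_fst (g := fun t => (t <= T)%R%:R)).
  rewrite (_ : (fun t => _) = \1_(`]-oo, T]%classic)).
    by apply: measurable_indic; exact: measurable_itv.
  by apply/funext => t; rewrite indicE mem_setE in_itv.
by apply: meas_snd; apply: measurable_indic; exact: measurable_box.
Qed.

Let integral_chi : (\int[leb1]_(t in I) \int[lebn]_x (chi t x)%:E =
  (T * box_volume n k rho)%:E)%E.
Proof.
have v0 := box_volume_ge0 n k rho_ge1.
transitivity (\int[leb1]_(t in I) ((box_volume n k rho)%:E * (\1_(`]-oo, T]%classic) t)%:E))%E.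
  apply: eq_integral => t _; under eq_integral do rewrite EFinM.
  rewrite ge0_integralZl//; last first.
    by apply/measurable_EFinP; apply: measurable_indic; exact: measurable_box.
  rewrite integral_indic//; last exact: measurable_box.
  rewrite setIT [X in (_ * X)%E](_ : _ = (box_volume n k rho)%:E).
    by rewrite muleC indicE mem_setE in_itv.
  exact: lebesgue_box.
rewrite ge0_integralZl//; last first.
  apply/measurable_EFinP; apply: measurable_funTS; apply: measurable_indic.
  exact: measurable_itv.
rewrite integral_indic//.
rewrite (_ : `]-oo, T]%classic `&` `]0, +oo[%classic = `]0, T]%classic).
  rewrite [X in (_ * X)%E](_ : _ = T%:E); first by rewrite muleC.
  apply: (etrans (lebesgue_measure_itv _)).
  by rewrite /= lte_fin T_gt0 oppr0 adde0.
by apply/seteqP; split => t /=; rewrite !in_itv/= andbT;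
  [move=> [-> ->]|move=> /andP[-> ->]].
Qed.

(** [young_half] integrated over time and space; [g] will be psi_t and then Delta_X psi. *)
Lemma weighted_le u (g : R -> Rn -> R) (B : R) : meas u -> meas g -> 0 <= B ->
  (forall t x, `|g t x| <= B / 2 * psi t x `^ p^-1) ->
  (`|\int[leb1]_(t in I) \int[lebn]_x (u t x * g t x)%:E| <=
   (2^-1)%:E * (\int[leb1]_(t in I) \int[lebn]_x (`|u t x| `^ p * psi t x)%:E
     + (B `^ q * (T * box_volume n k rho))%:E))%E.
Proof.
move=> mu mg B0 gB.
have mup : meas (fun t x => `|u t x| `^ p * psi t x).
  apply: (@measurable_funM _ _ _ _ (fun z : R * Rn => `|u z.1 z.2| `^ p)
    (fun z => psi z.1 z.2)); last exact: meas_pbump.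
  apply: (measurableT_comp (f := fun y : R => y `^ p)
    (g := fun z : R * Rn => `|u z.1 z.2|)); first exact: measurable_powR.
  exact: measurableT_comp.
have mB : meas (fun t x => B `^ q * chi t x).
  by apply: measurable_funM => //; exact: measurable_cst.
have chi0 t x : 0 <= chi t x by rewrite mulr_ge0.
have up0 t x : 0 <= `|u t x| `^ p * psi t x by rewrite mulr_ge0 ?powR_ge0 ?psi_ge0.
have B0' t x : 0 <= B `^ q * chi t x by rewrite mulr_ge0 ?powR_ge0.
rewrite EFinM -integral_chi -iteratedZl ?powR_ge0// -iteratedD//.
rewrite -iteratedZl//; last 2 first.
- exact: measurable_funD.
- by move=> t x _; rewrite addr_ge0.
apply: le_abse_iterated => //.
- exact: measurable_funM.
- by apply: measurable_funM; [exact: measurable_cst|exact: measurable_funD].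
move=> t x; rewrite /= in_itv/= andbT => t0; rewrite normrM.
by apply: young_half => //; [exact: psi_ge0|exact: psi_chi].
Qed.

(** The integral is restricted to times up to T/2, where [bump_half] bounds the cut-off from
    below. *)
Lemma sbump_itg_ge (c : R) : 0 <= c ->
  ((2^-1 ^+ N.+3 * (T / 2) * c)%:E <=
   \int[leb1]_(t in I) (sbump N T 0 t * c)%:E)%E.
Proof.
move=> c0; have T2 : 0 < T / 2 by rewrite divr_gt0.
have mJ : measurable (`]0, T / 2]%classic : set R) by exact: measurable_itv.
have msc D : measurable_fun D (fun t => (sbump N T 0 t * c)%:E).
  apply/measurable_EFinP; apply: measurable_funTS; apply: measurable_funM => //.
  by apply: continuous_measurable_fun; exact: continuous_sbump.
have sc0 t : (0 <= (sbump N T 0 t * c)%:E)%E.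
  by rewrite lee_fin mulr_ge0//; case/andP: (eta_bound t).
apply: (@le_trans _ _ (\int[leb1]_(t in `]0%R, (T / 2)%R]) (sbump N T 0 t * c)%:E)%E).
  apply: (@le_trans _ _ (\int[leb1]_(t in `]0%R, (T / 2)%R]) (2^-1 ^+ N.+3 * c)%:E)%E).
    rewrite integral_cst// [X in (_ * X)%E](_ : _ = (T / 2)%:E).
      by rewrite -EFinM lee_fin mulrAC.
    apply: (etrans (lebesgue_measure_itv _)).
    by rewrite /= lte_fin T2 oppr0 adde0.
  apply: ge0_le_integral => //.
  - by move=> t _; rewrite lee_fin mulr_ge0 ?exprn_ge0.
  - exact: msc.
  - move=> t /=; rewrite in_itv/= => /andP[t0 tT]; rewrite lee_fin ler_wpM2r//.
    rewrite /sbump expr0 invr1 mul1r bump_half// ger0_norm ?divr_ge0 ?(ltW t0) ?(ltW T_gt0)//.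
    by rewrite ler_pdivrMr// mulrC.
apply: ge0_subset_integral => //; first exact: msc.
by move=> t /=; rewrite !in_itv/= andbT => /andP[].
Qed.

(** [weighted_le] is used with [B] equal to twice the bounds on psi_t and Delta_X psi. As f does not
    depend on t, its term is the time integral of the cut-off times [c]. *)
Lemma weak_solution_bound f (u0 : Rn -> R) u (c : R) :
  global_weak_solution (@monomial_vf R n k) p f u0 u ->
  lebn.-integrable setT (fun x => (f x * phi x)%:E) ->
  (\int[lebn]_x (f x * phi x)%:E = c%:E)%E -> 0 <= c ->
  fine (\int[lebn]_x (u0 x * phi x)%:E)%E + 2^-1 ^+ N.+3 * (T / 2) * c <=
  2^-1 * ((2 * K / T) `^ q * (T * box_volume n k rho) +
    (2 * (n%:R * K ^+ n / rho ^+ 2)) `^ q * (T * box_volume n k rho)).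
Proof.
have IE : [set t : R | 0 < t /\ (t%:E < +oo)%E] = I.
  by apply/seteqP; split => t /=; rewrite in_itv/= andbT;
    [case|split=> //; exact: ltry].
move=> [[]]; rewrite IE => mu _ H fphi fc c0.
have {}H := H (fun t => psi t) (test_function_pbump N r_gt0 T_gt0) (fun t x _ _ => psi_ge0 t x).
have psi0 x : psi 0 x = phi x by rewrite psiE /sbump mul0r expr0 invr1 mul1r bump0 mul1r.
move: H => /=; under [X in (_ + X + _ + _ + _)%E]eq_integral do rewrite psi0.
move=> H; apply: (sum5_eq0_le H).
- by apply: iterated_ge0 => t x _; rewrite mulr_ge0 ?powR_ge0 ?psi_ge0.
- apply: (le_trans (sbump_itg_ge c0)); rewrite le_eqVlt; apply/orP; left; apply/eqP.
  apply: eq_integral => t _; rewrite EFinM -fc -integralZl//.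
  by apply: eq_integral => x _; rewrite -EFinM psiE mulrCA.
- apply: weighted_le => //.
    by rewrite divr_ge0 ?mulr_ge0 ?bump_cst_ge0 ?(ltW T_gt0).
  by move=> t x; rewrite (_ : 2 * K / T / 2 = K / T); [exact: derive_psi_le|field; rewrite gt_eqF].
- apply: weighted_le => //.
    by rewrite !mulr_ge0 ?exprn_ge0 ?bump_cst_ge0 ?invr_ge0 ?exprn_ge0// (le_trans _ rho_ge1).
  by move=> t x; rewrite [2 * _]mulrC mulfK//; exact: laplacian_psi_le.
Qed.

End main_inequality.

(** * Letting the box grow *)

Lemma integral_maxr d (S : measurableType d) (R : realType)
    (mu : {measure set S -> \bar R}) (g : S -> R) :
  (\int[mu]_x (g x)%:E =
   \int[mu]_x (Num.max (g x) 0)%:E - \int[mu]_x (Num.max (- g x) 0)%:E)%E.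
Proof.
rewrite integralE; congr (_ - _)%E; apply: eq_integral => x _.
  by rewrite funeposE EFin_max.
by rewrite funenegE EFin_max.
Qed.

Section limits.
Variables (R : realType) (n : nat) (k : nat -> nat -> nat) (N : nat).
Local Notation Rn := 'rV[R]_n.
Local Notation a0 := (fun=> 0%N).
Local Notation lebn := (lebesgue_row R n).
Local Notation phi rho := (pbump N (@anis R n k rho) 1 a0).

Lemma phi_nondecreasing (rho rho' : R) (x : Rn) : 1 <= rho -> rho <= rho' ->
  phi rho x <= phi rho' x.
Proof.
move=> r1 rr; rewrite /pbump !mul1r; apply: ler_prod => l _.
rewrite /sbump !expr0 !invr1 !mul1r bump_ge0/=; apply: bump_nincr.
rewrite !normrM ler_wpM2l// !normfV lef_pV2 ?posrE ?normr_gt0 ?gt_eqF//; last 2 first.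
- by rewrite anis_gt0// (le_trans r1).
- by rewrite anis_gt0.
have r0 : 0 < rho by rewrite (lt_le_trans _ r1).
rewrite !gtr0_norm ?anis_gt0// ?(le_trans r1)// /anis lerXn2r// nnegrE ltW//.
exact: lt_le_trans rr.
Qed.

Lemma phi_cvg1 (x : Rn) : phi m.+1%:R x @[m --> \oo] --> (1 : R).
Proof.
have H : \prod_(l < n) sbump N (anis k m.+1%:R l) 0 (x 0 l) @[m --> \oo] -->
    \prod_(l < n) (1 : R).
  apply: (@cvg_big R 'I_n *%R 1 xpredT (@mul_continuous R)) => l _.
  suff : bump N 0 (x 0 l / anis k m.+1%:R l) @[m --> \oo] --> bump N 0 (0 : R).
    rewrite bump0; apply: cvg_trans; apply: near_eq_cvg; apply: nearW => m.
    by rewrite /sbump expr0 invr1 mul1r.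
  apply: (cvg_comp (fun m : nat => x 0 l / anis k m.+1%:R l) (bump N 0) _
    (@continuous_bump R N 0 0)).
  apply/norm_cvg0P.
  (* Every degree sigma_l is at least 1, so the half-width is at least [m.+1%:R]. *)
  apply: (@squeeze_cvgr _ _ _ _ (cst 0) (fun m => `|x 0 l| * m.+1%:R^-1)).
  - apply: nearW => m; rewrite normr_ge0/= normrM ler_wpM2l// normfV.
    have m1 : 1 <= m.+1%:R :> R by rewrite ler1n.
    rewrite lef_pV2 ?posrE ?normr_gt0 ?gt_eqF ?anis_gt0//.
    rewrite gtr0_norm ?anis_gt0// /anis /hom_degree add1n exprS ler_peMr//.
    exact: exprn_ege1.
  - exact: cvg_cst.
  - rewrite -[X in _ --> X](mulr0 `|x 0 l|); apply: cvgM; first exact: cvg_cst.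
    exact: cvg_harmonic.
move: H; rewrite big1//; apply: cvg_trans; apply: near_eq_cvg; apply: nearW => m.
by rewrite /pbump mul1r.
Qed.

(** The bump is at most 1 and vanishes outside a compact box, so the product is dominated by |f| on
    that box. *)
Lemma integrable_mul_phi (rho : R) (f : Rn -> R) : 1 <= rho -> L1loc f ->
  lebn.-integrable setT (fun x => (f x * phi rho x)%:E).
Proof.
move=> r1 [mf fK].
have mfphi : measurable_fun setT (fun x => f x * phi rho x).
  by apply: measurable_funM => //; exact: measurable_pbump.
apply/integrableP; split; first exact/measurable_EFinP.
have cb := @compact_box R n (anis k rho); apply: le_lt_trans (fK _ cb).
have mb : measurable [set x : Rn | forall l, `|x 0 l| <= anis k rho l].
  exact: (@measurable_box R n k rho).
rewrite [leRHS]integral_mkcond; apply: ge0_le_integral => //.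
- by apply: measurableT_comp => //; exact/measurable_EFinP.
- apply/(measurable_restrictT _ mb); apply: measurable_funTS.
  by apply/measurable_EFinP; exact: measurableT_comp.
move=> x _ /=; rewrite patchE; case: ifPn => xb.
  rewrite lee_fin normrM ler_piMr// ger0_norm ?pbump_ge0//.
  exact: pbump_le1.
rewrite phi_out ?mulr0 ?normr0//.
by move=> H; move: xb; rewrite mem_set.
Qed.

(** Since the integral of f may be +oo, the two parts are treated differently: monotone convergence
    for the positive part, and the bound by the full integral for the negative part. *)
Lemma integral_mul_phi_gt0 (f : Rn -> R) : measurable_fun setT f ->
  (0 < \int[lebn]_x (f x)%:E)%E ->
  exists2 delta : R, 0 < delta & \forall m \near \oo,
    (delta%:E <= \int[lebn]_x (f x * phi m.+1%:R x)%:E)%E.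
Proof.
move=> mf; rewrite integral_maxr.
set fp := fun x => Num.max (f x) 0; set fn := fun x => Num.max (- f x) 0.
have mfp : measurable_fun setT fp by exact: measurable_maxr.
have mfn : measurable_fun setT fn.
  by apply: measurable_maxr => //; exact: measurable_funN.
have fp0 x : 0 <= fp x by rewrite le_max lexx orbT.
have fn0 x : 0 <= fn x by rewrite le_max lexx orbT.
have m1 m : 1 <= m.+1%:R :> R by rewrite ler1n.
have phi0 m x : 0 <= phi m.+1%:R x by rewrite pbump_ge0.
have phi1 m x : phi m.+1%:R x <= 1 by exact: pbump_le1.
have mphi m : measurable_fun setT (phi m.+1%:R) by exact: measurable_pbump.
have cvgp : (\int[lebn]_x (fp x * phi m.+1%:R x)%:E)%E @[m --> \oo] -->
    (\int[lebn]_x (fp x)%:E)%E.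
  rewrite [X in _ --> X](_ : _ = (\int[lebn]_x (limn (fun m => (fp x * phi m.+1%:R x)%:E)))%E).
    apply: cvg_monotone_convergence => //.
    - by move=> m; apply/measurable_EFinP; exact: measurable_funM.
    - by move=> m x _; rewrite lee_fin mulr_ge0.
    - move=> x _ a b ab; rewrite lee_fin ler_wpM2l// phi_nondecreasing//.
      by rewrite ler_nat.
  apply: eq_integral => x _; apply/esym/cvg_lim => //.
  apply: cvg_EFin; first by apply: nearW.
  rewrite -[X in _ --> X]mulr1; apply: cvgM; first exact: cvg_cst.
  exact: phi_cvg1.
set ip := (\int[lebn]_x (fp x)%:E)%E in cvgp *.
set im := (\int[lebn]_x (fn x)%:E)%E => ipim.
have im0 : (0 <= im)%E by apply: integral_ge0 => x _; rewrite lee_fin.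
(* A positive difference forces [im] to be finite, because subtracting +oo always yields -oo here.
   If [ip] is infinite, any [d] will do. *)
have [d d0 dip] : exists2 d : R, 0 < d & (im + d%:E < ip)%E.
  move: ip im ipim im0 {cvgp} => [a||] [b||]//.
  - rewrite -EFinB lte_fin => ab _; exists ((a - b) / 2); first lra.
    by rewrite -EFinD lte_fin; lra.
  - by move=> _ _; exists 1 => //; rewrite -EFinD ltry.
have imf : im \is a fin_num.
  by move: im0 dip {ipim}; case: im => //; case: ip {cvgp}.
exists d => //.
have H : \forall m \near \oo, (im + d%:E < \int[lebn]_x (fp x * phi m.+1%:R x)%:E)%E.
  have : nbhs ip [set y | (im + d%:E < y)%E].
    by apply: open_nbhs_nbhs; split => //; exact: open_ereal_gt_ereal.
  exact: cvgp.
apply: filterS H => m H; rewrite integral_maxr.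
rewrite [X in (X - _)%E](_ : _ = \int[lebn]_x (fp x * phi m.+1%:R x)%:E)%E; last first.
  by apply: eq_integral => x _; rewrite /fp maxr_pMl// mul0r.
have le_im : (\int[lebn]_x (Num.max (- (f x * phi m.+1%:R x)) 0)%:E <= im)%E.
  apply: ge0_le_integral => //.
  - by move=> x _; rewrite lee_fin le_max lexx orbT.
  - apply/measurable_EFinP; apply: measurable_maxr => //.
    by apply: measurable_funN; exact: measurable_funM.
  - exact/measurable_EFinP.
  - move=> x _; rewrite lee_fin -mulNr.
    rewrite (_ : Num.max _ _ = fn x * phi m.+1%:R x); last by rewrite maxr_pMl// mul0r.
    by rewrite ler_piMr.
apply: (@le_trans _ _ (\int[lebn]_x (fp x * phi m.+1%:R x)%:E - im)%E).
  by rewrite leeBrDr// addeC ltW.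
by rewrite leeB.
Qed.

(** The left-hand side is a constant times rho^(Q - 2q) with a negative exponent. [Y] is that
    constant divided by [e], and [m] is taken beyond Y^(1/s). *)
Lemma box_volume_decay (q C e : R) : 0 <= C -> 0 < e ->
  (n + total_nested_sum k n)%:R < 2 * q ->
  \forall m \near \oo,
    (2 * (C / m.+1%:R ^+ 2)) `^ q * box_volume n k m.+1%:R <= e.
Proof.
move=> C0 e0 Qq; set Q := (n + _)%N in Qq.
pose Y := 2 ^+ n * (2 * C) `^ q / e.
have Y0 : 0 <= Y by rewrite divr_ge0 ?mulr_ge0 ?exprn_ge0 ?powR_ge0// ltW.
pose s := 2 * q - Q%:R; have s0 : 0 < s by rewrite subr_gt0.
near=> m; set rho : R := m.+1%:R; have r0 : 0 < rho by [].
have Yrho : Y <= rho `^ s.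
  have YY : Y = (Y `^ s^-1) `^ s by rewrite -powRrM mulVf ?gt_eqF// powRr1.
  rewrite YY; apply: ge0_ler_powR; rewrite ?nnegrE ?powR_ge0 ?(ltW s0) ?(ltW r0)//.
  apply: (@le_trans _ _ m%:R); last by rewrite ler_nat.
  by near: m; exact: nbhs_infty_ger.
have E : (2 * (C / rho ^+ 2)) `^ q * box_volume n k rho = Y * e / rho `^ s.
  rewrite /box_volume -/Q [2 * (C / _)]mulrA powRM ?invr_ge0 ?exprn_ge0 ?mulr_ge0 ?(ltW r0)//.
  rewrite -powR_invn ?(ltW r0)// -powRrM -[rho ^+ Q]powR_mulrn ?(ltW r0)//.
  rewrite divfK ?gt_eqF// -powRN opprB powRD; last by rewrite (gt_eqF r0) implybT.
  rewrite (_ : rho `^ (- 2%:R * q) = rho `^ (- (2 * q))); last by congr powR; ring.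
  by ring.
rewrite E ler_pdivrMr ?powR_gt0// mulrC ler_wpM2l// ltW//.
Unshelve. all: end_near.
Qed.

End limits.

(** * Choice of the parameters and the contradiction *)

Theorem theorem4p9 (R : realType) (n : nat) (k : nat -> nat -> nat) (p : R)
    (u0 f : 'rV[R]_n -> R) :
  (2 < n)%N ->
  1 < p ->
  p < (n%:R + (total_nested_sum k n)%:R) /
      (n%:R - 2 + (total_nested_sum k n)%:R) ->
  L1loc u0 ->
  L1loc f ->
  (0 < \int[lebesgue_row R n]_x (f x)%:E)%E ->
  ~ exists u : R -> 'rV[R]_n -> R,
      global_weak_solution (@monomial_vf R n k) p f u0 u.
Proof.
move=> n2 p1 pQ _ Lf f0 [u Hu].
have p10 : 0 < p - 1 by rewrite subr_gt0.
have p0 : 0 < p by exact: lt_trans p1.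
pose q := p / (p - 1).
have q1 : 1 < q by rewrite ltr_pdivlMr// mul1r; lra.
have pq : p^-1 + q^-1 = 1.
  by rewrite /q invf_div; field; rewrite gt_eqF.
(* With q = p / (p - 1), the hypothesis p (Q - 2) < Q rewrites as Q (p - 1) < 2 p. *)
have Qq : (n + total_nested_sum k n)%:R < 2 * q :> R.
  rewrite natrD; set t := (total_nested_sum k n)%:R in pQ *.
  have t0 : 0 <= t :> R by [].
  have n3 : 3 <= n%:R :> R by rewrite ler_nat.
  move: pQ; rewrite ltr_pdivlMr; last by lra.
  by rewrite /q mulrA ltr_pdivlMr// => ?; nra.
(* The condition amounts to 2 <= (p - 1)(N + 1), which the chosen [N] satisfies because N > 3 / (p -
   1). *)
have [N Np] : exists N, N.+3%:R / p <= N.+1%:R :> R.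
  exists (Num.trunc (3 / (p - 1))).+1; rewrite ler_pdivrMr//.
  have := Num.Theory.truncnS_gt (3 / (p - 1)); set N := Num.trunc _.
  rewrite ltr_pdivrMr// -[N.+4%:R]natr1 -![N.+1.+2%:R]natr1 -![N.+1.+1%:R]natr1 => H.
  nra.
have [d d0 fd] := integral_mul_phi_gt0 k N Lf.1 f0.
pose K := bump_cst R N.
have K0 : 0 <= K := bump_cst_ge0 R N.
pose c := 2^-1 ^+ N.+3 * d; have c0 : 0 < c by rewrite mulr_gt0// exprn_gt0.
have CE0 : 0 <= n%:R * K ^+ n by rewrite mulr_ge0// exprn_ge0.
have c4 : 0 < c / 4 by rewrite divr_gt0.
have vd := box_volume_decay CE0 c4 Qq.
near \oo => m.
have r1 : 1 <= m.+1%:R :> R by rewrite ler1n.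
have fdm : (d%:E <= \int[lebesgue_row R n]_x (f x * pbump N (anis k m.+1%:R) 1 (fun=> 0%N) x)%:E)%E.
  by near: m.
have vdm : (2 * (n%:R * K ^+ n / m.+1%:R ^+ 2)) `^ q * box_volume n k m.+1%:R <= c / 4.
  by near: m.
have If := integrable_mul_phi k N r1 Lf.
have fE := fineK (integrable_fin_num measurableT If).
set F := fine _ in fE; rewrite -fE lee_fin in fdm.
set v := box_volume n k m.+1%:R in vdm.
have v0 : 0 <= v by exact: box_volume_ge0.
have F0 : 0 <= F by rewrite (le_trans _ fdm)// ltW.
pose b := fine (\int[lebesgue_row R n]_x (u0 x * pbump N (anis k m.+1%:R) 1 (fun=> 0%N) x)%:E)%E.
(* [T] is chosen after [m], since [b] and [v] depend on the box. The first summand gives 2K/T <= 1,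
   so that its power [q] is at most 2K/T; the next two make |b| and K v at most T c / 8; the last
   ensures positivity. *)
pose T := 2 * K + 8 * `|b| / c + 8 * K * v / c + 1.
have t2 : 0 <= 8 * `|b| / c by rewrite divr_ge0 ?(ltW c0)// !mulr_ge0.
have t3 : 0 <= 8 * K * v / c by rewrite divr_ge0 ?(ltW c0)// !mulr_ge0.
have T0 : 0 < T by rewrite /T; lra.
have := weak_solution_bound p1 q1 pq Np r1 T0 Hu If (esym fE) F0.
rewrite -/K -/v -/b.
have bT : 8 * `|b| <= T * c by rewrite -ler_pdivrMr// /T; lra.
have vT : 8 * K * v <= T * c by rewrite -ler_pdivrMr// /T; lra.
have B1 : (2 * K / T) `^ q * (T * v) <= 2 * K * v.
  rewrite [leRHS](_ : _ = (2 * K / T) * (T * v)); last by field; rewrite gt_eqF.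
  rewrite ler_wpM2r ?mulr_ge0 ?(ltW T0)//.
  have := K0; rewrite le_eqVlt => /predU1P[<-|Kgt].
    by rewrite mulr0 mul0r powR0// gt_eqF// (lt_trans _ q1).
  apply: ge1r_powR (ltW q1); rewrite divr_gt0 ?mulr_gt0//= ler_pdivrMr// mul1r /T; lra.
have B2 : (2 * (n%:R * K ^+ n / m.+1%:R ^+ 2)) `^ q * (T * v) <= T * (c / 4).
  by rewrite mulrCA ler_wpM2l// ltW.
have FT : T / 2 * c <= 2^-1 ^+ N.+3 * (T / 2) * F.
  by rewrite /c mulrCA mulrA ler_wpM2l// mulr_ge0 ?exprn_ge0// ltW// divr_gt0.
have bn := ler_norm (- b); rewrite normrN in bn.
have Tc : 0 < T * c by rewrite mulr_gt0.
(* The inequality gives T c / 2 <= |b| + K v + T c / 8, and each term on the right is at most T c /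
   8, which is impossible for T c > 0. *)
move: B1 B2 FT; set X1 := _ * (T * v); set X2 := _ * (T * v); set X3 := _ * F.
nra.
Unshelve. all: end_near.
Qed.
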